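(* Let $k\ge 1$, and let $G_1,\ldots,G_k$ be groups such that each $G_i$ is isomorphic to one of the following: (a) a finite group; (b) a finitely generated abelian group; (c) a finitely generated subgroup of a right-angled Artin group; (d) the Grigorchuk group; (e) the lamplighter group $(\mathbb{Z}/p\mathbb{Z})\wr\mathbb{Z}$ for some integer $p\ge 2$. Then the free product $G_1\ast\cdots\ast G_k$ belongs to $\mathcal{C}(\mathrm{lin})$. More generally, any graph product of a finite family of groups from the list (a)--(e) belongs to $\mathcal{C}(\mathrm{lin})$.
   Context: Growth of actions. Let $G$ be a finitely generated group with a finite symmetric generating set $S$, and let $B_G(n)$ be the ball of radius $n$ around the identity for the word metric of $S$. For a $G$-set $X$ (not assumed transitive), put $\mathrm{vol}_{G,X}(n)=\max_{x\in X}|B_G(n)\cdot x|$. For functions $f_1,f_2$, write $f_1(n)\preccurlyeq f_2(n)$ if there is a positive integer $C$ such that $f_1(n)\le C f_2(Cn)$ for all $n\ge 1$. Class $\mathcal{C}(\mathrm{lin})$: the class of finitely generated groups $G$ for which there exists a faithful $G$-set $X$ with $\mathrm{vol}_{G,X}(n)\preccurlyeq n$. Graph product. Let $I$ be a set, and let $c$ be a map from the set of pairs $(i,j)\in I^2$ with $i\ne j$ to $\{0,1\}$ such that $c(i,j)=c(j,i)$. For a family of groups $(G_i)_{i\in I}$, the graph product associated to $c$ is the quotient of the free product of the $G_i$ by the relations $[G_i,G_j]=1$ for all $i\neq j$ with $c(i,j)=1$. A right-angled Artin group is a graph product in which all $G_i$ are infinite cyclic. Grigorchuk group: the group of automorphisms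 of the rooted binary tree $\{0,1\}^*$ of finite binary words generated by $a,b,c,d$, where $a(0w)=1w$, $a(1w)=0w$; $b(0w)=0a(w)$, $b(1w)=1c(w)$; $c(0w)=0a(w)$, $c(1w)=1d(w)$; $d(0w)=0w$, $d(1w)=1b(w)$ (and all fix the empty word). *)

(* Defs.v *)
From HB Require Import structures.
From mathcomp Require Import all_boot all_algebra.
From mathcomp Require Import boolp classical_sets functions cardinality.

Set Implicit Arguments.
Unset Strict Implicit.
Unset Printing Implicit Defensive.

Import GRing.Theory.
Local Open Scope classical_set_scope.
Local Open Scope group_scope.

(* Groups are MathComp's (possibly infinite) [groupType]s. The eqType and
   choiceType structures they carry are no restriction: by the axioms of
   [boolp], every type has them. *)

Section Subgroups.
Context {G : groupType}.

Definition is_subgroup (H : set G) : Prop :=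
  [/\ H 1, forall x y, H x -> H y -> H (x * y) & forall x, H x -> H x^-1].

Definition is_normal_subgroup (N : set G) : Prop :=
  is_subgroup N /\ forall x g, N x -> N (x ^ g).

Definition generated (A : set G) : set G := smallest is_subgroup A.

Definition normal_closure (A : set G) : set G := smallest is_normal_subgroup A.

Definition fin_gen (H : set G) : Prop :=
  exists S : seq G, H = generated [set` S].

Lemma generated_subgroup (A : set G) : is_subgroup (generated A).
Proof.
split=> [H [[h1 _ _] _] //|x y Hx Hy H HA|x Hx H HA].
- by have [[_ HM _] _] := HA; apply: HM; [apply: Hx|apply: Hy].
- by have [[_ _ HV] _] := HA; apply: HV; apply: Hx.
Qed.

Lemma normal_closure_normal (A : set G) : is_normal_subgroup (normal_closure A).
Proof.
split; first split=> [H [[[h1 _ _] _] _] //|x y Hx Hy H HA|x Hx H HA].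
- by have [[[_ HM _] _] _] := HA; apply: HM; [apply: Hx|apply: Hy].
- by have [[[_ _ HV] _] _] := HA; apply: HV; apply: Hx.
- by move=> x g Hx H HA; have [[_ HJ] _] := HA; apply: HJ; apply: Hx.
Qed.

End Subgroups.

Definition isog_onto (G K : groupType) (H : set K) : Prop :=
  exists f : {multiplicative G -> K}, injective f /\ range f = H.

Section Growth.
Context {G : groupType}.

Record gset := GSet {
  gset_carrier :> choiceType;
  gact : G -> gset_carrier -> gset_carrier;
  gact1 : forall x, gact 1 x = x;
  gactM : forall g h x, gact (g * h) x = gact g (gact h x)
}.

Definition faithful_gset (X : gset) : Prop :=
  forall g : G, (forall x : X, gact g x = x) -> g = 1.

Definition sym_generating (S : seq G) : Prop :=
  (forall s, s \in S -> s^-1 \in S) /\ generated [set` S] = [set: G].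

(* The ball of radius [n], as a list that may contain repetitions. *)
Fixpoint ball (S : seq G) (n : nat) : seq G :=
  if n is m.+1 then ball S m ++ [seq s * g | s <- S, g <- ball S m] else [:: 1].

Lemma ballP (S : seq G) (n : nat) (g : G) :
  g \in ball S n <->
  exists w : seq G, [/\ {subset w <= S}, (size w <= n)%N & g = \prod_(s <- w) s].
Proof.
elim: n g => [|n IH] g /=.
  rewrite inE; split=> [/eqP ->|[[|s w] [_ // _ ->]]]; last by rewrite big_nil.
  by exists [::]; rewrite big_nil.
rewrite mem_cat; split.
  case/orP=> [/IH [w [wS wn ->]]|/allpairsP[[s h] /= [sS /IH [w [wS wn ->]] ->]]].
    by exists w; split=> //; apply: leqW.
  exists (s :: w); split=> //; last by rewrite big_cons.
  by move=> t; rewrite inE => /orP[/eqP ->|/wS].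
case=> [[|s w] [wS wn ->]]; apply/orP.
  by left; apply/IH; exists [::]; split.
right; rewrite big_cons; apply: allpairs_f; first by rewrite wS ?mem_head.
by apply/IH; exists w; split=> // t tw; rewrite wS // inE tw orbT.
Qed.

Definition orbit_card (S : seq G) (X : gset) (n : nat) (x : X) : nat :=
  size (undup [seq gact g x | g <- ball S n]).

(* The maximum over [x : X] of [|B(n) . x|]: the values taken are at most the
   size of the list [ball S n], so they are selected among these numbers. *)
Definition vol (S : seq G) (X : gset) (n : nat) : nat :=
  \max_(m < (size (ball S n)).+1 | `[< exists x : X, orbit_card S n x = m >]) m.

Lemma orbit_card_le_vol (S : seq G) (X : gset) (n : nat) (x : X) :
  (orbit_card S n x <= vol S X n)%N.
Proof.
have lt : (orbit_card S n x < (size (ball S n)).+1)%N.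
  by rewrite ltnS (leq_trans (size_undup _)) ?size_map.
apply: (@leq_bigmax_cond _ _ (fun m : 'I__ => m : nat) (Ordinal lt)).
by apply/asboolP; exists x.
Qed.

Lemma vol_attained (S : seq G) (X : gset) (n : nat) (x0 : X) :
  exists x : X, orbit_card S n x = vol S X n.
Proof.
have lt : (orbit_card S n x0 < (size (ball S n)).+1)%N.
  by rewrite ltnS (leq_trans (size_undup _)) ?size_map.
rewrite /vol (bigmax_eq_arg (Ordinal lt)); last by apply/asboolP; exists x0.
by case: arg_maxnP => [|i /asboolP[x <-] _]; [apply/asboolP; exists x0|exists x].
Qed.

End Growth.
Arguments gset : clear implicits.

Definition preceq (f1 f2 : nat -> nat) : Prop :=
  exists2 C : nat, (0 < C)%N &
    forall n : nat, (1 <= n)%N -> (f1 n <= C * f2 (C * n))%N.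

(* The order of growth does not depend on the generating set; the bound is
   required for all of them. *)
Definition class_lin (G : groupType) : Prop :=
  fin_gen [set: G] /\
  exists X : gset G, faithful_gset X /\
    forall S : seq G, sym_generating S -> preceq (vol S X) (fun n => n).

(* The quotient of [G] by the normal closure of [R]. *)
Section QuotientGroup.
Variables (G : groupType) (R : set G).
Implicit Types x y z : G.

Definition quo_rel x y : bool := `[< normal_closure R (x^-1 * y) >].

Fact quo_rel_refl : reflexive quo_rel.
Proof.
by move=> x; apply/asboolP; rewrite mulVg; case: (normal_closure_normal R) => -[].
Qed.

Fact quo_rel_symmetric : symmetric quo_rel.
Proof.
have [[_ _ HV] _] := normal_closure_normal R.
by move=> x y; apply/idP/idP=> /asboolP /HV h; apply/asboolP; move: h;
  rewrite invgM invgK.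
Qed.

Fact quo_rel_trans : transitive quo_rel.
Proof.
have [[_ HM _] _] := normal_closure_normal R.
move=> y x z /asboolP xy /asboolP yz; apply/asboolP.
by have := HM _ _ xy yz; rewrite mulgA mulgK.
Qed.

Canonical quo_equiv := EquivRel quo_rel quo_rel_refl quo_rel_symmetric quo_rel_trans.

Definition quotient_group : Type := {eq_quot quo_equiv}%qT.
HB.instance Definition _ := Choice.on quotient_group.
HB.instance Definition _ := EqQuotient.on quotient_group.

Local Open Scope quotient_scope.

Definition quo_mk x : quotient_group := \pi_quotient_group x.

Lemma quo_mkP x y : quo_mk x = quo_mk y <-> normal_closure R (x^-1 * y).
Proof. by split=> [/eqmodP /asboolP|h] //; apply/eqmodP/asboolP. Qed.

Lemma quo_mkK (a : quotient_group) : quo_mk (repr a) = a.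
Proof. exact: reprK. Qed.

Definition quo_mul (a b : quotient_group) : quotient_group :=
  quo_mk (repr a * repr b).
Definition quo_inv (a : quotient_group) : quotient_group := quo_mk (repr a)^-1.
Definition quo_one : quotient_group := quo_mk 1.

Lemma quo_mkM x y : quo_mk (x * y) = quo_mul (quo_mk x) (quo_mk y).
Proof.
have [[_ HM HV] HJ] := normal_closure_normal R.
have /quo_mkP := esym (quo_mkK (quo_mk x)); set x' := repr _ => hx.
have /quo_mkP := esym (quo_mkK (quo_mk y)); set y' := repr _ => hy.
apply/quo_mkP; rewrite -/x' -/y'.
have -> : (x * y)^-1 * (x' * y') = (x^-1 * x') ^ y * (y^-1 * y').
  by rewrite conjgE invgM !mulgA mulgK.
by apply: HM => //; apply: HJ.
Qed.

Lemma quo_mkV x : quo_mk x^-1 = quo_inv (quo_mk x).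
Proof.
have [[_ HM HV] HJ] := normal_closure_normal R.
have /quo_mkP := quo_mkK (quo_mk x); set x' := repr _ => hx.
apply/quo_mkP; rewrite -/x' invgK.
by have := HJ _ x'^-1 hx; rewrite conjgE invgK !mulgA mulgV mul1g.
Qed.

Fact quo_mulA : associative quo_mul.
Proof.
move=> a b c; rewrite -(quo_mkK a) -(quo_mkK b) -(quo_mkK c).
by rewrite -!quo_mkM mulgA.
Qed.
Fact quo_mul1 : left_id quo_one quo_mul.
Proof. by move=> a; rewrite -(quo_mkK a) -quo_mkM mul1g. Qed.
Fact quo_mulr1 : right_id quo_one quo_mul.
Proof. by move=> a; rewrite -(quo_mkK a) -quo_mkM mulg1. Qed.
Fact quo_mulV : left_inverse quo_one quo_inv quo_mul.
Proof. by move=> a; rewrite -(quo_mkK a) -quo_mkV -quo_mkM mulVg. Qed.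
Fact quo_mulrV : right_inverse quo_one quo_inv quo_mul.
Proof. by move=> a; rewrite -(quo_mkK a) -quo_mkV -quo_mkM mulgV. Qed.

HB.instance Definition _ :=
  isGroup.Build quotient_group quo_mulA quo_mul1 quo_mulr1 quo_mulV quo_mulrV.

End QuotientGroup.

(* The free product: words in the disjoint union of the [G i], up to the
   congruence that deletes identity letters and multiplies out adjacent letters
   of the same factor. *)
Section FreeProduct.
Variables (I : choiceType) (G : I -> groupType).

Definition letter : Type := {i : I & G i}.
HB.instance Definition _ := Choice.on letter.

Definition mk_letter (i : I) (x : G i) : letter := existT (fun i => G i : Type) i x.

Implicit Types u v w : seq letter.

Inductive fp_eqv : seq letter -> seq letter -> Prop :=
| FpRefl u : fp_eqv u u
| FpSym u v : fp_eqv u v -> fp_eqv v u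
| FpTrans u v w : fp_eqv u v -> fp_eqv v w -> fp_eqv u w
| FpOne u v i : fp_eqv (u ++ mk_letter (1 : G i) :: v) (u ++ v)
| FpMul u v i (x y : G i) :
    fp_eqv (u ++ [:: mk_letter x, mk_letter y & v])
           (u ++ mk_letter (x * y) :: v).

Lemma fp_eqv_cat u u' v v' : fp_eqv u u' -> fp_eqv v v' -> fp_eqv (u ++ v) (u' ++ v').
Proof.
move=> uu' vv'; apply: (@FpTrans _ (u' ++ v)).
  elim: uu' => {u u' vv'} [u|u w _|u w t _ h1 _ h2|u w i|u w i x y].
  - exact: FpRefl.
  - exact: FpSym.
  - exact: FpTrans h1 h2.
  - by rewrite -!catA; apply: FpOne.
  - by rewrite -!catA; apply: FpMul.
elim: vv' => {v v' uu'} [v|v w _|v w t _ h1 _ h2|v w i|v w i x y].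
- exact: FpRefl.
- exact: FpSym.
- exact: FpTrans h1 h2.
- by rewrite !catA; apply: FpOne.
- by rewrite !catA; apply: FpMul.
Qed.

Definition inv_letter (l : letter) : letter := mk_letter (projT2 l)^-1.
Definition inv_word w : seq letter := rev (map inv_letter w).

Lemma inv_wordK : involutive inv_word.
Proof.
move=> w; rewrite /inv_word map_rev revK -map_comp map_id_in // => -[i x] _.
by rewrite /= /inv_letter /= invgK.
Qed.

Lemma fp_eqv_inv u v : fp_eqv u v -> fp_eqv (inv_word u) (inv_word v).
Proof.
elim=> {u v} [u|u v _|u v w _ h1 _ h2|u v i|u v i x y].
- exact: FpRefl.
- exact: FpSym.
- exact: FpTrans h1 h2.
- rewrite /inv_word !map_cat !rev_cat /= rev_cons cat_rcons /inv_letter /= invg1.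
  exact: FpOne.
- rewrite /inv_word !map_cat !rev_cat /= !rev_cons !cat_rcons /inv_letter /= invgM.
  exact: FpMul.
Qed.

Lemma fp_eqv_catV w : fp_eqv (w ++ inv_word w) [::].
Proof.
elim/last_ind: w => [|w [i x] IH]; first exact: FpRefl.
rewrite /inv_word map_rcons rev_rcons cat_rcons -/(inv_word w).
apply: FpTrans (FpMul _ _ _ _) _; rewrite /= mulgV.
exact: FpTrans (FpOne _ _ _) IH.
Qed.

Definition fp_rel u v : bool := `[< fp_eqv u v >].

Fact fp_rel_refl : reflexive fp_rel.
Proof. by move=> u; apply/asboolP/FpRefl. Qed.
Fact fp_rel_symmetric : symmetric fp_rel.
Proof. by move=> u v; apply/asboolP/asboolP; apply: FpSym. Qed.
Fact fp_rel_trans : transitive fp_rel.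
Proof. by move=> v u w /asboolP uv /asboolP vw; apply/asboolP/(FpTrans uv vw). Qed.

Canonical fp_equiv := EquivRel fp_rel fp_rel_refl fp_rel_symmetric fp_rel_trans.

Definition free_product : Type := {eq_quot fp_equiv}%qT.
HB.instance Definition _ := Choice.on free_product.
HB.instance Definition _ := EqQuotient.on free_product.

Local Open Scope quotient_scope.

Definition fp_word w : free_product := \pi_free_product w.

Lemma fp_wordP u v : fp_word u = fp_word v <-> fp_eqv u v.
Proof. by split=> [/eqmodP /asboolP|h] //; apply/eqmodP/asboolP. Qed.

Lemma fp_wordK (a : free_product) : fp_word (repr a) = a.
Proof. exact: reprK. Qed.

Definition fp_mul (a b : free_product) : free_product := fp_word (repr a ++ repr b).
Definition fp_inv (a : free_product) : free_product := fp_word (inv_word (repr a)).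
Definition fp_one : free_product := fp_word [::].

Lemma fp_word_cat u v : fp_word (u ++ v) = fp_mul (fp_word u) (fp_word v).
Proof. by apply/fp_wordP/fp_eqv_cat; apply/fp_wordP; rewrite fp_wordK. Qed.

Lemma fp_word_inv u : fp_word (inv_word u) = fp_inv (fp_word u).
Proof. by apply/fp_wordP/fp_eqv_inv/fp_wordP; rewrite fp_wordK. Qed.

Fact fp_mulA : associative fp_mul.
Proof.
move=> a b c; rewrite -(fp_wordK a) -(fp_wordK b) -(fp_wordK c).
by rewrite -!fp_word_cat catA.
Qed.
Fact fp_mul1 : left_id fp_one fp_mul.
Proof. by move=> a; rewrite -(fp_wordK a) -fp_word_cat. Qed.
Fact fp_mulr1 : right_id fp_one fp_mul.
Proof. by move=> a; rewrite -(fp_wordK a) -fp_word_cat cats0. Qed.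
Fact fp_mulrV : right_inverse fp_one fp_inv fp_mul.
Proof.
move=> a; rewrite -(fp_wordK a) -fp_word_inv -fp_word_cat.
exact/fp_wordP/fp_eqv_catV.
Qed.
Fact fp_mulV : left_inverse fp_one fp_inv fp_mul.
Proof.
move=> a; rewrite -(fp_wordK a) -fp_word_inv -fp_word_cat -{2}[repr a]inv_wordK.
exact/fp_wordP/fp_eqv_catV.
Qed.

HB.instance Definition _ :=
  isGroup.Build free_product fp_mulA fp_mul1 fp_mulr1 fp_mulV fp_mulrV.

Definition fp_inj (i : I) (x : G i) : free_product := fp_word [:: mk_letter x].

End FreeProduct.

Section GraphProduct.
Variables (I : choiceType) (c : I -> I -> bool) (G : I -> groupType).

(* Only pairs of distinct indices are used: [c i i] is irrelevant. *)
Definition graph_relators : set (free_product G) :=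
  [set r | exists i j (x : G i) (y : G j),
     [/\ i != j, c i j & r = [~ fp_inj x, fp_inj y]]].

Definition graph_product : groupType := quotient_group graph_relators.

End GraphProduct.

Definition infinite_cyclic (G : groupType) : Prop :=
  infinite_set [set: G] /\ exists g : G, generated [set g] = [set: G].

Definition fg_subgroup_of_RAAG (G : groupType) : Prop :=
  exists (I : choiceType) (c : I -> I -> bool) (A : I -> groupType)
         (H : set (graph_product c A)),
    [/\ forall i j, i != j -> c i j = c j i,
        forall i, infinite_cyclic (A i),
        is_subgroup H, fin_gen H
      & isog_onto G H].

(* Automorphisms of the rooted binary tree on [seq bool], in which the children
   of [w] are the words [rcons w x]; [false] and [true] stand for 0 and 1. *)
Record tree_aut := TreeAut {
  tree_fun :> seq bool -> seq bool;
  tree_bij : bijective tree_fun;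
  tree_root : tree_fun [::] = [::];
  tree_edge : forall w x, exists y, tree_fun (rcons w x) = rcons (tree_fun w) y
}.
HB.instance Definition _ := gen_eqMixin tree_aut.
HB.instance Definition _ := gen_choiceMixin tree_aut.

Lemma tree_autP (f g : tree_aut) : f =1 g -> f = g.
Proof.
case: f g => [f f1 f2 f3] [g g1 g2 g3] /= /funext fg.
by subst g; congr TreeAut; apply: Prop_irrelevance.
Qed.

Section TreeAutGroup.
Implicit Types f g h : tree_aut.

Definition tree_one : tree_aut.
Proof.
by apply: (@TreeAut id) => // [|w x]; [exact: Bijective|exists x].
Defined.

Definition tree_mul f g : tree_aut.
Proof.
apply: (@TreeAut (f \o g)) => [||w x] /=.
- exact: bij_comp (tree_bij f) (tree_bij g).
- by rewrite !tree_root.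
- by have [y ->] := tree_edge g w x; apply: tree_edge.
Defined.

Lemma tree_inv_ex f : exists g : seq bool -> seq bool, cancel f g /\ cancel g f.
Proof. by case: (tree_bij f) => g; exists g. Qed.

Definition tree_inv_fun f : seq bool -> seq bool := projT1 (cid (tree_inv_ex f)).
Lemma tree_funK f : cancel f (tree_inv_fun f).
Proof. by rewrite /tree_inv_fun; case: cid => g []. Qed.
Lemma tree_funKV f : cancel (tree_inv_fun f) f.
Proof. by rewrite /tree_inv_fun; case: cid => g []. Qed.

Definition tree_inv f : tree_aut.
Proof.
apply: (@TreeAut (tree_inv_fun f)) => [||w x].
- exact: Bijective (tree_funKV f) (tree_funK f).
- by rewrite -{1}(tree_root f) tree_funK.
- have fKV := tree_funKV f; have := fKV (rcons w x).
  case/lastP: (tree_inv_fun f (rcons w x)) => [|v z].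
    by rewrite tree_root => /(congr1 size); rewrite size_rcons.
  have [y ->] := tree_edge f v z => /rcons_inj [<- _].
  by exists z; rewrite tree_funK.
Defined.

Fact tree_mulA : associative tree_mul. Proof. by move=> f g h; apply: tree_autP. Qed.
Fact tree_mul1 : left_id tree_one tree_mul. Proof. by move=> f; apply: tree_autP. Qed.
Fact tree_mulr1 : right_id tree_one tree_mul. Proof. by move=> f; apply: tree_autP. Qed.
Fact tree_mulV : left_inverse tree_one tree_inv tree_mul.
Proof. by move=> f; apply: tree_autP => w /=; rewrite tree_funK. Qed.
Fact tree_mulrV : right_inverse tree_one tree_inv tree_mul.
Proof. by move=> f; apply: tree_autP => w /=; rewrite tree_funKV. Qed.

HB.instance Definition _ :=
  isGroup.Build tree_aut tree_mulA tree_mul1 tree_mulr1 tree_mulV tree_mulrV.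

End TreeAutGroup.

Section Grigorchuk.

Definition fun_a (w : seq bool) : seq bool :=
  if w is x :: v then ~~ x :: v else [::].

Fixpoint fun_b (w : seq bool) : seq bool :=
  match w with
  | [::] => [::]
  | false :: v => false :: fun_a v
  | true :: v => true :: fun_c v
  end
with fun_c (w : seq bool) : seq bool :=
  match w with
  | [::] => [::]
  | false :: v => false :: fun_a v
  | true :: v => true :: fun_d v
  end
with fun_d (w : seq bool) : seq bool :=
  match w with
  | [::] => [::]
  | false :: v => false :: v
  | true :: v => true :: fun_b v
  end.

Fact fun_aK : involutive fun_a. Proof. by case=> [|[]]. Qed.

Fact fun_bcdK : [/\ involutive fun_b, involutive fun_c & involutive fun_d].
Proof.
suff h w : [/\ fun_b (fun_b w) = w, fun_c (fun_c w) = w & fun_d (fun_d w) = w].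
  by split=> w; case: (h w).
elim: w => [//|[] w [hb hc hd]] /=; rewrite ?fun_aK ?hb ?hc ?hd //.
Qed.
Fact fun_bK : involutive fun_b. Proof. by case: fun_bcdK. Qed.
Fact fun_cK : involutive fun_c. Proof. by case: fun_bcdK. Qed.
Fact fun_dK : involutive fun_d. Proof. by case: fun_bcdK. Qed.

Fact fun_a_edge w x : exists y, fun_a (rcons w x) = rcons (fun_a w) y.
Proof. by case: w => [|z w]; [exists (~~ x)|exists x]. Qed.

Fact fun_bcd_edge w x :
  [/\ exists y, fun_b (rcons w x) = rcons (fun_b w) y,
      exists y, fun_c (rcons w x) = rcons (fun_c w) y
    & exists y, fun_d (rcons w x) = rcons (fun_d w) y].
Proof.
elim: w => [|[] w [[yb hb] [yc hc] [yd hd]]] /=.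
- by case: x; split; eexists.
- by split; [exists yc; rewrite hc|exists yd; rewrite hd|exists yb; rewrite hb].
- have [y ha] := fun_a_edge w x.
  by split; [exists y; rewrite ha|exists y; rewrite ha|exists x].
Qed.
Fact fun_b_edge w x : exists y, fun_b (rcons w x) = rcons (fun_b w) y.
Proof. by case: (fun_bcd_edge w x). Qed.
Fact fun_c_edge w x : exists y, fun_c (rcons w x) = rcons (fun_c w) y.
Proof. by case: (fun_bcd_edge w x). Qed.
Fact fun_d_edge w x : exists y, fun_d (rcons w x) = rcons (fun_d w) y.
Proof. by case: (fun_bcd_edge w x). Qed.

Definition aut_a : tree_aut := TreeAut (inv_bij fun_aK) (erefl [::]) fun_a_edge.
Definition aut_b : tree_aut := TreeAut (inv_bij fun_bK) (erefl [::]) fun_b_edge.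
Definition aut_c : tree_aut := TreeAut (inv_bij fun_cK) (erefl [::]) fun_c_edge.
Definition aut_d : tree_aut := TreeAut (inv_bij fun_dK) (erefl [::]) fun_d_edge.

Definition Grigorchuk_group : set tree_aut :=
  generated [set` [:: aut_a; aut_b; aut_c; aut_d]].

End Grigorchuk.

(* The restricted wreath product of Z/pZ by Z: finitely supported functions from
   Z to Z/pZ, extended by Z acting by translation. As 'Z_p is Z/2Z when p < 2,
   this is only used for p >= 2. *)
Record lamplighter (p : nat) := Lamplighter {
  lamp : int -> 'Z_p;
  cursor : int;
  lamp_finite : finite_set [set i | lamp i != 0%R]
}.

Section LamplighterGroup.
Variable p : nat.
Implicit Types s t : lamplighter p.

HB.instance Definition _ := gen_eqMixin (lamplighter p).
HB.instance Definition _ := gen_choiceMixin (lamplighter p).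

Lemma lamplighterP s t : lamp s =1 lamp t -> cursor s = cursor t -> s = t.
Proof.
case: s t => [f m hf] [g n hg] /= /funext fg mn; subst g n.
by congr Lamplighter; apply: Prop_irrelevance.
Qed.

Fact lamp_shift_finite s (m : int) :
  finite_set [set i | lamp s (i - m)%R != 0%R].
Proof.
apply: sub_finite_set (finite_image (fun i => (i + m)%R) (lamp_finite s)).
by move=> i /= hi; exists (i - m)%R => //; rewrite subrK.
Qed.

Definition ll_one : lamplighter p.
Proof.
apply: (@Lamplighter p (fun=> 0%R) 0%R).
by apply: sub_finite_set (finite_set0 int) => i /eqP.
Defined.

Definition ll_mul s t : lamplighter p.
Proof.
apply: (@Lamplighter p (fun i => lamp s i + lamp t (i - cursor s))%R
          (cursor s + cursor t)%R).
have hU : finite_set ([set i | lamp s i != 0%R] `|`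
                      [set i | lamp t (i - cursor s)%R != 0%R]).
  by rewrite finite_setU; split; [apply: lamp_finite|apply: lamp_shift_finite].
apply: sub_finite_set hU => i /=; have [->|] := eqVneq (lamp s i) 0%R; last by left.
by rewrite add0r; right.
Defined.

Definition ll_inv s : lamplighter p.
Proof.
apply: (@Lamplighter p (fun i => - lamp s (i + cursor s))%R (- cursor s)%R).
apply: sub_finite_set (lamp_shift_finite s (- cursor s)%R) => i /=.
by rewrite oppr_eq0 opprK.
Defined.

Fact ll_mulA : associative ll_mul.
Proof.
move=> s t r; apply: lamplighterP => [i|] /=; last by rewrite addrA.
by rewrite opprD !addrA.
Qed.
Fact ll_mul1 : left_id ll_one ll_mul.
Proof. by move=> s; apply: lamplighterP => [i|] /=; rewrite ?subr0 add0r. Qed.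
Fact ll_mulr1 : right_id ll_one ll_mul.
Proof. by move=> s; apply: lamplighterP => [i|] /=; rewrite addr0. Qed.
Fact ll_mulV : left_inverse ll_one ll_inv ll_mul.
Proof. by move=> s; apply: lamplighterP => [i|] /=; rewrite ?opprK addNr. Qed.
Fact ll_mulrV : right_inverse ll_one ll_inv ll_mul.
Proof. by move=> s; apply: lamplighterP => [i|] /=; rewrite ?subrK subrr. Qed.

HB.instance Definition _ :=
  isGroup.Build (lamplighter p) ll_mulA ll_mul1 ll_mulr1 ll_mulV ll_mulrV.

End LamplighterGroup.

Inductive building_block (G : groupType) : Prop :=
| BlockFinite of finite_set [set: G]
| BlockAbelian of fin_gen [set: G] & (forall x y : G, x * y = y * x)
| BlockRAAG of fg_subgroup_of_RAAG G
| BlockGrigorchuk of isog_onto G Grigorchuk_group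
| BlockLamplighter (p : nat) of (2 <= p)%N & isog_onto G [set: lamplighter p].

(* Main.v *)
(* Call G linearly separated if, uniformly in g <> 1, there is a G-set X with a
   height function rho : X -> nat such that every element of G is Lipschitz for
   rho, the fibers of rho have bounded size, and g maps a point of height 0 to a
   point of maximal, positive height.  The disjoint union of these G-sets is
   faithful of linear growth.

   The property passes to graph products.  Take a reduced word for w and read it
   from the right, keeping a letter only when it does not commute with the letter
   kept last.  Glue the sets attached to the kept letters into a chain, the top
   of each to the bottom of the next, and let a vertex group act on the sets
   attached to its own letters only.  Consecutive vertices do not commute, so the
   groups at commuting vertices act with disjoint supports and the graph product
   acts; heights add up along the chain and w moves its bottom to its top.

   The building blocks are separated by finite quotients and by cycles Z/2k, by
   the levels of the binary tree for the Grigorchuk group, and by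
   Z/(2L+1) x Z/p for the lamplighter group. *)

From HB Require Import structures.
Require Import Defs.
From mathcomp Require Import all_boot all_algebra.
From mathcomp Require Import boolp classical_sets functions cardinality fsbigop.
From mathcomp Require Import zify.

Set Implicit Arguments.
Unset Strict Implicit.
Unset Printing Implicit Defensive.

Import GRing.Theory.
Local Open Scope classical_set_scope.
Local Open Scope group_scope.

(** * Separation by actions of linear growth *)

(** Measured by duplicate-free lists, so that no finiteness of [T] enters the statement. *)
Definition fibers_le (T U : eqType) (f : T -> U) (C : nat) : Prop :=
  forall (k : U) (s : seq T), uniq s -> {in s, forall z, f z = k} -> (size s <= C)%N.

Lemma fibers_leW (T U : eqType) (f : T -> U) (C D : nat) :
  (C <= D)%N -> fibers_le f C -> fibers_le f D.
Proof. by move=> CD fC k s us sk; apply: leq_trans CD; apply: fC us sk. Qed.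

Lemma size_le_fibers (T U : eqType) (f : T -> U) (C : nat) (r : seq U) (s : seq T) :
  fibers_le f C -> uniq s -> {in s, forall z, f z \in r} -> (size s <= size r * C)%N.
Proof.
move=> fC; elim: r s => [|k r IH] s us sr.
  by case: s us sr => // z s _ /(_ z (mem_head _ _)).
rewrite -(count_predC (fun z => f z == k)) mulSn -!size_filter leq_add //.
  by apply: (fC k); rewrite ?filter_uniq // => z; rewrite mem_filter => /andP[/eqP].
apply: IH; rewrite ?filter_uniq // => z; rewrite mem_filter => /andP[/= zk /sr].
by rewrite inE (negPf zk).
Qed.

(** [M] and [C] are fixed before [g] in [linearly_separated]; this uniformity lets witnesses for
    different elements be united or glued. The image of [x] has maximal height so that the next set
    of a chain can be placed above it. *)
Definition separation_witness (G : groupType) (M : G -> nat) (C : nat) (g : G) : Prop :=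
  exists (X : gset G) (rho : X -> nat) (x : X),
    [/\ rho x = 0%N, (0 < rho (gact g x))%N,
        forall z, (rho z <= rho (gact g x))%N,
        forall h z, (rho (gact h z) <= rho z + M h)%N
      & fibers_le rho C].

Definition linearly_separated (C : nat) (G : groupType) : Prop :=
  exists M : G -> nat, forall g : G, g != 1 -> separation_witness M C g.

Lemma separation_witnessW (G : groupType) (M N : G -> nat) (C D : nat) (g : G) :
  (forall h, (M h <= N h)%N) -> (C <= D)%N -> separation_witness M C g -> separation_witness N D g.
Proof.
move=> MN CD [X [rho [x [h1 h2 h3 h4 h5]]]]; exists X, rho, x; split=> //.
  by move=> h z; apply: leq_trans (h4 h z) _; rewrite leq_add2l.
exact: fibers_leW h5.
Qed.

Lemma separatedW (C D : nat) (G : groupType) : (C <= D)%N ->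
  linearly_separated C G -> linearly_separated D G.
Proof. by move=> CD [M h]; exists M => g /h; apply: separation_witnessW. Qed.

Lemma morph_1 (G K : groupType) (f : G -> K) : {morph f : x y / x * y} -> f 1 = 1.
Proof. by move=> fM; apply: (@mulgI _ (f 1)); rewrite -fM !mulg1. Qed.

Lemma morph_V (G K : groupType) (f : G -> K) :
  {morph f : x y / x * y} -> {morph f : x / x^-1}.
Proof.
by move=> fM x; apply: (@mulgI _ (f x)); rewrite -fM !mulgV; apply: morph_1.
Qed.

Section Pullback.
Variables (G K : groupType) (f : G -> K) (fM : {morph f : x y / x * y}) (X : gset K).

Definition pull_act (g : G) (x : X) : X := gact (f g) x.

Fact pull_act1 x : pull_act 1 x = x.
Proof. by rewrite /pull_act (morph_1 fM) gact1. Qed.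
Fact pull_actM g h x : pull_act (g * h) x = pull_act g (pull_act h x).
Proof. by rewrite /pull_act fM gactM. Qed.

Definition pull_gset : gset G := GSet pull_act1 pull_actM.

End Pullback.

Lemma separation_witness_pull (G K : groupType) (f : G -> K) (M : K -> nat) (C : nat) (g : G) :
  {morph f : x y / x * y} -> separation_witness M C (f g) -> separation_witness (M \o f) C g.
Proof.
move=> fM [X [rho [x [h1 h2 h3 h4 h5]]]]; exists (pull_gset fM X), rho, x; split=> //.
by move=> h z; apply: h4.
Qed.

Lemma separated_inj (C : nat) (G K : groupType) (f : G -> K) :
  {morph f : x y / x * y} -> injective f -> linearly_separated C K -> linearly_separated C G.
Proof.
move=> fM finj [M h]; exists (M \o f) => g g1; apply: separation_witness_pull => //.
by apply: h; apply: contraNneq g1 => fg1; rewrite -(inj_eq finj) fg1 (morph_1 fM).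
Qed.

(* Truncated subtraction: one of the two differences is 0. *)
Definition dist (a b : nat) : nat := (a - b) + (b - a).

(** A triangular wave: the distance from [t] to the nearest multiple of [2D], which is 0 at 0 and
    maximal at [D]. *)
Definition fold (D t : nat) : nat := minn (t %% D.*2) (D.*2 - t %% D.*2).

Lemma foldS (D t : nat) : (0 < D)%N ->
  (fold D t.+1 <= (fold D t).+1)%N /\ (fold D t <= (fold D t.+1).+1)%N.
Proof.
move=> D0; rewrite /fold -addn1 -(modnDml t).
have : (t %% D.*2 < D.*2)%N by rewrite ltn_mod; lia.
move: (t %% D.*2) => r rD.
have [r1|r1] := ltnP (r + 1) D.*2; first by rewrite (modn_small r1); lia.
have -> : (r + 1 = D.*2)%N by lia.
by rewrite modnn; lia.
Qed.

Lemma fold_dist (D t u : nat) : (0 < D)%N -> (fold D t <= fold D u + dist t u)%N.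
Proof.
move=> D0.
have up n v : (fold D (v + n) <= fold D v + n)%N /\ (fold D v <= fold D (v + n) + n)%N.
  elim: n => [|n [h1 h2]]; first by rewrite addn0; lia.
  by have [] := foldS (v + n) D0; rewrite !addnS; lia.
have [tu|ut] := leqP t u.
  by have := up (u - t)%N t; rewrite /dist subnKC //; lia.
by have := up (t - u)%N u; rewrite /dist (subnKC (ltnW ut)); lia.
Qed.

(** If the distance from [t] to [a] folds to [k], it is [2qD + k] or [2(q+1)D - k], with [t] on
    either side of [a]. Truncation may add spurious entries, but only the length of the list
    counts. *)
Definition fold_preimages (D K a k : nat) : seq nat :=
  flatten [seq [:: a + (q * D.*2 + k); a + (q.+1 * D.*2 - k);
                   a - (q * D.*2 + k); a - (q.+1 * D.*2 - k)]%N | q <- iota 0 K.+1].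

Lemma size_fold_preimages (D K a k : nat) : size (fold_preimages D K a k) = (4 * K.+1)%N.
Proof.
rewrite /fold_preimages; move: {1}0%N => m.
by elim: K.+1 m => [|n IH] m; rewrite ?muln0 //= IH; lia.
Qed.

Lemma mem_fold_preimages (D K a t : nat) : (0 < D)%N -> (dist t a <= K * D)%N ->
  t \in fold_preimages D K a (fold D (dist t a)).
Proof.
move=> D0 tK; apply/flatten_mapP; exists (dist t a %/ D.*2).
  by rewrite mem_iota leq0n add0n /= ltn_divLR; nia.
have := divn_eq (dist t a) D.*2.
have : (dist t a %% D.*2 < D.*2)%N by rewrite ltn_mod; lia.
rewrite /= /fold; move: (_ %% _) (_ %/ _) => r q rD.
rewrite /dist mulSn => tE; rewrite !inE; lia.
Qed.

(* It suffices that [g] moves [x] by a fixed proportion of the range of [rho]: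
   folding the range at [rho x] and [rho (gact g x)] then makes these extremal. *)
Lemma fold_witness (G : groupType) (M : G -> nat) (C K L : nat) (g : G)
    (X : gset G) (rho : X -> nat) (x : X) :
  (forall z, rho z <= L)%N -> (0 < dist (rho (gact g x)) (rho x))%N ->
  (L <= K * dist (rho (gact g x)) (rho x))%N ->
  (forall h z, (rho (gact h z) <= rho z + M h)%N) -> fibers_le rho C ->
  separation_witness (fun h => M h + M h^-1)%N (4 * K.+1 * C) g.
Proof.
set D := dist _ _ => rhoL D0 LK rhoM rhoC.
exists X, (fun z => fold D (dist (rho z) (rho x))), x.
have fD : fold D D = D by rewrite /fold modn_small; lia.
have fle t : (fold D t <= D)%N.
  by rewrite /fold; move: (_ %% _); lia.
split; rewrite -/D ?fD //.
- by rewrite /dist subnn /fold mod0n; lia.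
(* Folding reverses some directions, so drops of [rho] must be bounded as well; the bound for [h^-1]
   at [gact h z] does this. *)
- move=> h z; have := rhoM h z; have := rhoM h^-1 (gact h z).
  rewrite -gactM mulVg gact1.
  have := fold_dist (dist (rho (gact h z)) (rho x)) (dist (rho z) (rho x)) D0.
  by move: (fold _ _) (fold _ _); rewrite /dist; lia.
- move=> k s us sk.
  rewrite -(size_fold_preimages D K (rho x) k).
  apply: size_le_fibers rhoC us _ => z zs; rewrite -(sk z zs).
  apply: mem_fold_preimages => //; apply: leq_trans LK.
  by have := rhoL z; have := rhoL x; rewrite /dist; lia.
Qed.

(** * Disjoint unions of witnesses and linear growth *)

Section DisjointUnion.
Variables (G : groupType) (J : choiceType) (X : J -> gset G).

Definition du_act (g : G) (p : {j : J & X j}) : {j : J & X j} :=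
  existT (fun j => X j : Type) (projT1 p) (gact g (projT2 p)).

Fact du_act1 p : du_act 1 p = p.
Proof. by case: p => j x; rewrite /du_act gact1. Qed.
Fact du_actM g h p : du_act (g * h) p = du_act g (du_act h p).
Proof. by rewrite /du_act gactM. Qed.

Definition du_gset : gset G := GSet du_act1 du_actM.

End DisjointUnion.

Lemma ball_height (G : groupType) (X : gset G) (rho : X -> nat) (S : seq G) (K n : nat) (g : G) :
  (forall h z, h \in S ->
     (rho (gact h z) <= rho z + K)%N /\ (rho z <= rho (gact h z) + K)%N) ->
  g \in ball S n ->
  forall z, (rho (gact g z) <= rho z + n * K)%N /\ (rho z <= rho (gact g z) + n * K)%N.
Proof.
move=> SK; elim: n g => [|n IH] g /=; first by rewrite inE => /eqP -> z; rewrite gact1; lia.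
rewrite mem_cat => /orP[/IH h z|/allpairsP[[s h] /= [sS /IH hb ->]] z].
  by have := h z; lia.
by rewrite gactM; have := hb z; have := SK s (gact h z) sS; lia.
Qed.

(** The heights met by the orbit lie within [n * K] of [rho x], and each height carries at most [C]
    points. *)
Lemma orbit_card_bound (G : groupType) (X : gset G) (rho : X -> nat) (S : seq G)
    (C K n : nat) (x : X) :
  (forall h z, h \in S ->
     (rho (gact h z) <= rho z + K)%N /\ (rho z <= rho (gact h z) + K)%N) ->
  fibers_le rho C -> (orbit_card S n x <= (2 * (n * K)).+1 * C)%N.
Proof.
move=> SK rhoC; rewrite /orbit_card.
set s := undup _; rewrite -(size_iota (rho x - n * K) (2 * (n * K)).+1).
apply: size_le_fibers rhoC (undup_uniq _) _ => z.
rewrite mem_undup => /mapP[g gn ->]; rewrite mem_iota.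
by have := ball_height SK gn x; lia.
Qed.

Lemma class_lin_separated (C : nat) (G : groupType) :
  fin_gen [set: G] -> linearly_separated C G -> class_lin G.
Proof.
move=> fgG [M H]; split=> //.
(* One witness is chosen for each nontrivial element. In the union, [g] moves the base point of its
   own component, since the height there changes. *)
have H' (j : {g : G | g != 1}) := cid (H (val j) (valP j)).
pose X j := projT1 (H' j); have XP j := projT2 (H' j).
exists (du_gset X); split.
  move=> g fixg; apply/eqP/contraT => g1.
  have [rho [x [x0 gx _ _ _]]] := XP (Sub g g1).
  have /eqP := fixg (existT (fun j => X j : Type) (Sub g g1) x).
  by rewrite eq_Tagged /= => /eqP gxx; rewrite /= gxx x0 in gx.
move=> S _.
pose K := \max_(s <- S) maxn (M s) (M s^-1).
exists (2 * K * C + C).+1 => // n n1.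
apply: (@leq_trans ((2 * (n * K)).+1 * C)); last by nia.
apply/bigmax_leqP => m /asboolP[[j x] <-].
have [rho [_ [_ _ _ rhoM rhoC]]] := XP j.
(* An orbit stays inside one component, so it can be counted there. *)
have -> : orbit_card S n (existT (fun j => X j : Type) j x : du_gset X) = orbit_card S n x.
  rewrite /orbit_card (eq_map (g := Tagged (fun j => X j : Type) \o (fun g => gact g x))) //.
  rewrite map_comp undup_map_inj ?size_map // => a b /eqP.
  by rewrite eq_Tagged => /eqP.
apply: (orbit_card_bound (rho := rho)) rhoC => h z hS.
have hK : (maxn (M h) (M h^-1) <= K)%N by apply: leq_bigmax_seq.
have := rhoM h z; have := rhoM h^-1 (gact h z); rewrite -gactM mulVg gact1; lia.
Qed.

(** * Graph products *)

Lemma quo_mk_morph (G : groupType) (R : set G) : {morph quo_mk R : x y / x * y}.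
Proof. exact: quo_mkM. Qed.

(** * Actions of graph products given by vertex groups *)

Section Families.
Variables (I : choiceType) (c : I -> I -> bool) (G : I -> groupType).
Implicit Types w : seq (letter G).

(** An action of the graph product presented by its vertex groups. Gluing changes the groups one at
    a time, so it is done at this level; [gp_gset] then yields the action itself. *)
Record family := Family {
  fam_carrier :> choiceType;
  fam_act : forall i, G i -> fam_carrier -> fam_carrier;
  fam_act1 : forall i t, fam_act (1 : G i) t = t;
  fam_actM : forall i (g h : G i) t, fam_act (g * h) t = fam_act g (fam_act h t);
  fam_actC : forall i j (g : G i) (h : G j) t,
    i != j -> c i j -> fam_act g (fam_act h t) = fam_act h (fam_act g t)
}.

Section WordAction.
Variable F : family.
Implicit Types (t : F) (a b : free_product G).

Definition wact w t : F := foldr (fun l => fam_act (projT2 l)) t w.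

Lemma wact_cat u v t : wact (u ++ v) t = wact u (wact v t).
Proof. by rewrite /wact foldr_cat. Qed.

Lemma wact_eqv u v : fp_eqv u v -> wact u =1 wact v.
Proof.
elim=> {u v} [u|u v _ IH|u v w _ h1 _ h2|u v i|u v i x y] t //.
- by rewrite h1.
- by rewrite !wact_cat /= fam_act1.
- by rewrite !wact_cat /= fam_actM.
Qed.

Definition fp_act a t : F := wact (repr a) t.

Lemma fp_act_word w t : fp_act (fp_word w) t = wact w t.
Proof. by apply: wact_eqv; apply/fp_wordP; rewrite fp_wordK. Qed.

Lemma fp_act1 t : fp_act 1 t = t.
Proof. exact: (fp_act_word [::]). Qed.

Lemma fp_actM a b t : fp_act (a * b) t = fp_act a (fp_act b t).
Proof. by rewrite [a * b]/(fp_mul a b) fp_act_word wact_cat. Qed.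

Lemma fp_act_inj i (g : G i) t : fp_act (fp_inj g) t = fam_act g t.
Proof. exact: fp_act_word. Qed.

(** The elements acting trivially form a normal subgroup, and it contains the relators because the
    corresponding vertex actions commute. *)
Lemma fp_act_relators a : normal_closure (graph_relators c (G := G)) a -> forall t, fp_act a t = t.
Proof.
pose N : set (free_product G) := [set a | forall t, fp_act a t = t].
suff NP : is_normal_subgroup N /\ graph_relators c (G := G) `<=` N by move=> /(_ N NP).
split; first split; first split=> [t|x y xN yN t|x xN t].
- exact: fp_act1.
- by rewrite fp_actM yN xN.
- by rewrite -{1}(xN t) -fp_actM mulVg fp_act1.
- by move=> x g xN t; rewrite conjgE !fp_actM xN -fp_actM mulVg fp_act1.
move=> _ [i [j [x [y [ij cij ->]]]]] t.
have inv_inj k (g : G k) s : fp_act (fp_inj g)^-1 (fam_act g s) = s.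
  by rewrite -fp_act_inj -fp_actM mulVg fp_act1.
by rewrite commgEl conjgE !fp_actM !fp_act_inj fam_actC // !inv_inj.
Qed.

Definition gp_act (a : graph_product c G) t : F := fp_act (repr a) t.

Lemma gp_act_mk (a : free_product G) t : gp_act (quo_mk _ a) t = fp_act a t.
Proof.
rewrite /gp_act; set b := repr _.
have /quo_mkP h : quo_mk (graph_relators c (G := G)) a = quo_mk _ b by rewrite quo_mkK.
by rewrite -{2}(fp_act_relators h t) -fp_actM mulVKg.
Qed.

Fact gp_act1 t : gp_act 1 t = t.
Proof. by rewrite [1]/(quo_mk _ 1) gp_act_mk fp_act1. Qed.
Fact gp_actM (a b : graph_product c G) t : gp_act (a * b) t = gp_act a (gp_act b t).
Proof.
by rewrite -(quo_mkK a) -(quo_mkK b) -quo_mk_morph !gp_act_mk fp_actM.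
Qed.

Definition gp_gset : gset (graph_product c G) := GSet gp_act1 gp_actM.

End WordAction.

Section Concentrated.
Variables (v : I) (X : gset (G v)).

(** [G v] acts through [X] and the other vertex groups act trivially. Matching on [i =P v] provides
    the equality along which [g] is transported to [G v]. *)
Definition conc_act i (g : G i) (t : X) : X :=
  if i =P v is ReflectT e then gact (eq_rect i G g v e) t else t.

Lemma conc_act_v (g : G v) t : conc_act g t = gact g t.
Proof. by rewrite /conc_act; case: eqP => // e; rewrite (Prop_irrelevance e erefl). Qed.

Lemma conc_act_neq i (g : G i) t : i != v -> conc_act g t = t.
Proof. by rewrite /conc_act; case: eqP. Qed.

Fact conc_act1 i t : conc_act (1 : G i) t = t.
Proof.
have [->|iv] := eqVneq i v; first by rewrite conc_act_v gact1.
exact: conc_act_neq.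
Qed.

Fact conc_actM i (g h : G i) t : conc_act (g * h) t = conc_act g (conc_act h t).
Proof.
have [iv|iv] := eqVneq i v; last by rewrite !conc_act_neq.
by move: g h; rewrite iv => g h; rewrite !conc_act_v gactM.
Qed.

Fact conc_actC i j (g : G i) (h : G j) t :
  i != j -> c i j -> conc_act g (conc_act h t) = conc_act h (conc_act g t).
Proof.
have [iv|iv] := eqVneq i v; last by rewrite !(conc_act_neq g).
by move=> ij _; rewrite !(conc_act_neq h) // -iv eq_sym.
Qed.

Definition concentrated : family := Family conc_act1 conc_actM conc_actC.

End Concentrated.

(* The wedge of [F] at [y] and of [X] at [x].  Instead of removing a point from
   the disjoint union, [inr x] is kept as a fixed point and [inl y] plays the
   role of [x]. *)
Section Wedge.
Variables (F : family) (y : F) (v : I) (X : gset (G v)) (x : X).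
Hypothesis vy : forall g : G v, fam_act g y = y.
Hypothesis cy : forall i (g : G i), i != v -> c i v || c v i -> fam_act g y = y.

Definition wedge_in (t : X) : F + X := if t == x then inl y else inr t.

Definition wedge_act i (g : G i) (p : F + X) : F + X :=
  match p with
  | inl z => if (z == y) && (i == v) then wedge_in (@fam_act (concentrated X) i g x)
             else inl (fam_act g z)
  | inr t => if t == x then inr x
             else if i == v then wedge_in (@fam_act (concentrated X) i g t) else inr t
  end.

Lemma wedge_act_in (g : G v) (t : X) : wedge_act g (wedge_in t) = wedge_in (gact g t).
Proof.
rewrite {1}/wedge_in; have [->|tx] := eqVneq t x; rewrite /= ?eqxx /=.
  by rewrite conc_act_v.
by rewrite (negPf tx) conc_act_v.
Qed.

Lemma wedge_act_v (g : G v) (z : F) :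
  z != y -> wedge_act g (inl z) = inl (fam_act g z) /\ fam_act g z != y.
Proof.
move=> zy /=; rewrite (negPf zy); split=> //; apply: contra_neq zy => gz.
by rewrite -(@fam_act1 F v z) -(mulVg g) fam_actM gz vy.
Qed.

Lemma wedge_act_neq i (g : G i) (p : F + X) :
  i != v -> wedge_act g p = if p is inl z then inl (fam_act g z) else p.
Proof.
move=> iv; case: p => [z|t] /=; rewrite (negPf iv) ?andbF //.
by case: eqVneq => [->|].
Qed.

(** These three parts are invariant under [G v]: [F] without [y], the copy of [X] glued at [y], and
    the spare point [inr x]. *)
Lemma wedge_cases (p : F + X) :
  [\/ exists2 z, z != y & p = inl z, exists t, p = wedge_in t | p = inr x].
Proof.
case: p => [z|t]; last first.
  have [->|tx] := eqVneq t x; first by constructor 3.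
  by constructor 2; exists t; rewrite /wedge_in (negPf tx).
have [->|zy] := eqVneq z y; last by constructor 1; exists z.
by constructor 2; exists x; rewrite /wedge_in eqxx.
Qed.

Fact wedge_act1 i p : wedge_act (1 : G i) p = p.
Proof.
have [->|iv] := eqVneq i v; last by rewrite wedge_act_neq //; case: p => // z; rewrite fam_act1.
case: (wedge_cases p) => [[z zy ->]|[t ->]|->].
- by have [-> _] := wedge_act_v 1 zy; rewrite fam_act1.
- by rewrite wedge_act_in gact1.
- by rewrite /= eqxx.
Qed.

Fact wedge_actM i (g h : G i) p : wedge_act (g * h) p = wedge_act g (wedge_act h p).
Proof.
have [iv|iv] := eqVneq i v; last first.
  by rewrite !wedge_act_neq //; case: p => // z; rewrite fam_actM.
move: g h; rewrite iv => g h.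
case: (wedge_cases p) => [[z zy ->]|[t ->]|->].
- have [-> hz] := wedge_act_v h zy; have [-> _] := wedge_act_v g hz.
  by have [-> _] := wedge_act_v (g * h) zy; rewrite fam_actM.
- by rewrite !wedge_act_in gactM.
- by rewrite /= eqxx /= eqxx.
Qed.

(** Off [y] both elements act as on [F], and [h], which fixes [y], does not lead there. On the copy
    of [X] only [g] acts, and [inr x] is fixed by both. *)
Lemma wedge_actC_v j (g : G v) (h : G j) p :
  j != v -> c v j || c j v -> (forall z, fam_act g (fam_act h z) = fam_act h (fam_act g z) :> F) ->
  wedge_act g (wedge_act h p) = wedge_act h (wedge_act g p).
Proof.
move=> jv cvj gh; have hy := cy h jv; rewrite orbC in hy.
case: (wedge_cases p) => [[z zy ->]|[t ->]|->].
- have [-> _] := wedge_act_v g zy; rewrite !(wedge_act_neq h) //.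
  have hz : fam_act h z != y.
    apply: contra_neq zy => hz.
    by rewrite -(@fam_act1 F j z) -(mulVg h) fam_actM hz cy // orbC.
  by have [-> _] := wedge_act_v g hz; rewrite gh.
- have hin s : wedge_act h (wedge_in s) = wedge_in s.
    by rewrite wedge_act_neq // /wedge_in; case: eqP => // _; rewrite hy.
  by rewrite wedge_act_in !hin wedge_act_in.
- by rewrite /= eqxx /= eqxx.
Qed.

Fact wedge_actC i j (g : G i) (h : G j) p :
  i != j -> c i j -> wedge_act g (wedge_act h p) = wedge_act h (wedge_act g p).
Proof.
have [iv|iv] := eqVneq i v.
  move: g; rewrite iv eq_sym => g jv cvj; apply: wedge_actC_v; rewrite ?cvj // => z.
  by apply: fam_actC; rewrite // eq_sym.
have [jv|jv] := eqVneq j v.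
  move: h; rewrite jv => h {}iv civ; apply/esym/wedge_actC_v; rewrite ?civ ?orbT // => z.
  by apply/esym/fam_actC.
by move=> ij cij; rewrite !wedge_act_neq //; case: p => // z; rewrite fam_actC.
Qed.

Definition wedge : family := Family wedge_act1 wedge_actM wedge_actC.

End Wedge.

(** * Reduced words *)

Hypothesis c_sym : forall i j, i != j -> c i j = c j i.

Definition gp_word w : graph_product c G := quo_mk _ (fp_word w).

Lemma gp_word_cat u v : gp_word (u ++ v) = gp_word u * gp_word v.
Proof. by rewrite /gp_word fp_word_cat quo_mk_morph. Qed.

Lemma gp_word_cons l w : gp_word (l :: w) = gp_word [:: l] * gp_word w.
Proof. by rewrite -gp_word_cat. Qed.

Lemma gp_word_repr (a : graph_product c G) : exists w, gp_word w = a.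
Proof. by exists (repr (repr a)); rewrite /gp_word fp_wordK quo_mkK. Qed.

Lemma gp_letter1 i : gp_word [:: mk_letter (1 : G i)] = 1.
Proof. by congr quo_mk; apply/fp_wordP/(FpOne [::]). Qed.

Lemma gp_letterM i (g h : G i) :
  gp_word [:: mk_letter g] * gp_word [:: mk_letter h] = gp_word [:: mk_letter (g * h)].
Proof. by rewrite -gp_word_cat; congr quo_mk; apply/fp_wordP/(FpMul [::]). Qed.

Lemma gp_letterC i j (g : G i) (h : G j) : i != j -> c i j ->
  gp_word [:: mk_letter g] * gp_word [:: mk_letter h] =
  gp_word [:: mk_letter h] * gp_word [:: mk_letter g].
Proof.
move=> ij cij; rewrite /gp_word -/(fp_inj g) -/(fp_inj h) -!quo_mk_morph commgC.
rewrite [LHS]quo_mk_morph (_ : quo_mk _ [~ _, _] = 1) ?mulg1 //.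
apply/esym/quo_mkP; rewrite invg1 mul1g => N [_]; apply.
by exists i, j, g, h.
Qed.

(* A further letter at [v] in front of [w] could be merged with a letter of [w]. *)
Fixpoint blocked (v : I) w : bool :=
  if w is l :: w' then (projT1 l == v) || (c v (projT1 l) && blocked v w') else false.

Fixpoint reduced w : bool :=
  if w is l :: w' then
    [&& projT2 l != 1, ~~ blocked (projT1 l) w' & reduced w']
  else true.

(** The new letter travels right through letters it commutes with until it meets one at [v], and is
    multiplied into it; the length of [w] is kept. *)
Lemma blocked_merge v w (g : G v) : blocked v w ->
  exists2 w2, size w2 = size w & gp_word (mk_letter g :: w) = gp_word w2.
Proof.
elim: w => [//|[i h] w IH] /=; have [iv _|iv /= /andP[cvi /IH[w2 sw2 w2E]]] := eqVneq i v.
  move: h; rewrite iv => h; exists (mk_letter (g * h) :: w) => //.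
  by rewrite gp_word_cons (gp_word_cons _ w) mulgA gp_letterM -(gp_word_cons _ w).
exists (mk_letter h :: w2); first by rewrite /= sw2.
rewrite gp_word_cons (gp_word_cons _ w) mulgA gp_letterC // 1?eq_sym //.
by rewrite -mulgA -(gp_word_cons _ w) w2E -(gp_word_cons _ w2).
Qed.

(** A trivial letter could be deleted and a blocked one merged, each giving a shorter word; suffixes
    of a shortest word are again shortest. *)
Lemma shortest_reduced w :
  (forall w2, gp_word w2 = gp_word w -> (size w <= size w2)%N) -> reduced w.
Proof.
elim: w => [//|[i g] w IH] wmin /=; apply/and3P; split.
- apply/negP => /eqP g1; move: wmin; rewrite g1 => /(_ w).
  by rewrite gp_word_cons gp_letter1 mul1g => /(_ erefl); rewrite ltnn.
- apply/negP => /(blocked_merge g)[w2 sw2 w2E].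
  by have := wmin w2 (esym w2E); rewrite /= sw2 ltnn.
- apply: IH => w2 w2E; have := wmin (mk_letter g :: w2).
  by rewrite gp_word_cons w2E -gp_word_cons => /(_ erefl).
Qed.

(** * Chains of witnesses along a reduced word *)

Section Chains.
Variables (m : forall i, G i -> nat) (C : nat).
Arguments m {i}.
Hypothesis C0 : (0 < C)%N.
Hypothesis witness : forall i (g : G i), g != 1 -> separation_witness m C g.

Definition word_cost w : nat := \sum_(l <- w) m (projT2 l).

(** Follows [x] through the suffixes of [w]: whenever the path stands at [y], the next letter is at
    a vertex satisfying [ok]. When a set for a vertex outside [ok] is glued at [y], the path
    therefore does not enter it. *)
Fixpoint avoids (F : family) (x y : F) (ok : pred I) w : bool :=
  if w is l :: w' then ((wact w' x == y) ==> ok (projT1 l)) && avoids x y ok w' else true.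

(* The letters at [i] commute with the last block of the chain. *)
Definition commutes_last (o : option I) (i : I) : bool :=
  if o is Some j then (i != j) && c i j else false.

(** The invariant of the induction on [w]; [o] is the vertex of the last block, [None] for a single
    point. The top fiber has the sharper bound [C], because at the next gluing height it is joined
    by a bottom fiber of at most [C] points, which makes [2 * C]. *)
Definition chain (o : option I) w : Prop :=
  exists (F : family) (rho : F -> nat) (x : F),
    [/\ [/\ rho x = 0%N, w != [::] -> (0 < rho (wact w x))%N
          & forall z, (rho z <= rho (wact w x))%N],
        forall i (g : G i) z, (rho (fam_act g z) <= rho z + m g)%N,
        fibers_le rho (2 * C) /\
        (forall s, uniq s -> {in s, forall z, rho z = rho (wact w x)} -> (size s <= C)%N),
        forall i (g : G i), o != Some i -> fam_act g (wact w x) = wact w x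
      & avoids x (wact w x) (commutes_last o) w].

Lemma chain_nil : chain None [::].
Proof.
pose F := @Family unit (fun _ _ t => t) (fun _ _ => erefl)
  (fun _ _ _ _ => erefl) (fun _ _ _ _ _ _ _ => erefl).
exists F, (fun=> 0%N), tt.
have sz (s : seq unit) : uniq s -> (size s <= 1)%N.
  by move=> us; apply: (@uniq_leq_size _ s [:: tt]) => // -[]; rewrite inE.
split=> //; split=> [k s us _|s us _]; apply: leq_trans (sz s us) _; lia.
Qed.

(** Such a letter is at a vertex other than the last one, hence fixes the top: it is skipped and the
    chain stays the same. *)
Lemma chain_commute o i (g : G i) w :
  w != [::] -> chain o w -> commutes_last o i -> chain o (mk_letter g :: w).
Proof.
move=> w0 [F [rho [x [[r1 r2 r3] r4 [r5 r6] r7 r8]]]] oi.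
have gfix : fam_act g (wact w x) = wact w x.
  by apply: r7; case: o oi {r8} => [j /andP[ij _]|//]; rewrite eq_sym (inj_eq Some_inj).
exists F, rho, x; rewrite /= gfix oi implybT; split=> //; split=> // _.
exact: r2.
Qed.

(** The path could leave [F] only by a letter at [v] read at [y], which [avoids] excludes. *)
Lemma wact_wedge_inl (F : family) (x y : F) v (X : gset (G v)) (x0 : X)
    (vy : forall g : G v, fam_act g y = y)
    (cy : forall i (g : G i), i != v -> c i v || c v i -> fam_act g y = y) ok w :
  avoids x y ok w -> ~~ ok v ->
  wact w (inl x : wedge x0 vy cy) = inl (wact w x).
Proof.
move=> + okv; elim: w => [//|[i g] w IH] /= /andP[iok /IH ->] /=.
have [iv|//] := eqVneq i v; last by rewrite andbF.
by case: eqP iok => //= _ oki; case/negP: okv; case: _ / iv.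
Qed.

Lemma size_sum_split (S T : eqType) (s : seq (S + T)) :
  uniq s -> exists s1 s2, [/\ uniq s1, uniq s2, size s = (size s1 + size s2)%N,
    {in s1, forall z, inl z \in s} & {in s2, forall z, inr z \in s}].
Proof.
elim: s => [|[z|z] s IH] /=; first by exists [::], [::].
  case/andP=> zs /IH[s1 [s2 [u1 u2 -> h1 h2]]]; exists (z :: s1), s2.
  have zs1 : uniq (z :: s1) by rewrite /= u1 andbT; apply: contra zs => /h1.
  by split=> // t; rewrite !inE => /orP[/eqP ->|/h1 ->]; rewrite ?eqxx ?orbT.
case/andP=> zs /IH[s1 [s2 [u1 u2 -> h1 h2]]]; exists s1, (z :: s2).
have zs2 : uniq (z :: s2) by rewrite /= u2 andbT; apply: contra zs => /h2.
split=> // [|t]; first by rewrite addnS.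
by rewrite !inE => /orP[/eqP ->|/h2 ->]; rewrite ?eqxx ?orbT.
Qed.

(** Here a block is added. The top is fixed by all vertex groups except that of [o]; neither [v] nor
    a vertex commuting with [v] equals [o], so the conditions for the wedge hold. *)
Lemma chain_wedge o v (h : G v) w : h != 1 ->
  chain o w -> ~~ commutes_last o v -> o != Some v -> chain (Some v) (mk_letter h :: w).
Proof.
move=> /witness[X [sg [x0 [s1 s2 s3 s4 s5]]]] [F [rho [x [[r1 r2 r3] r4 [r5 r6] r7 r8]]]] ov ov'.
set y := wact w x in r2 r3 r6 r7 r8.
have vy (g : G v) : fam_act g y = y by apply: r7.
have cy i (g : G i) : i != v -> c i v || c v i -> fam_act g y = y.
  move=> iv civ; apply: r7; apply: contraNneq ov => ->.
  by rewrite /= eq_sym iv /=; move: civ; rewrite c_sym ?orbb.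
pose W := wedge x0 vy cy.
have wE : wact w (inl x : W) = inl y by apply: wact_wedge_inl r8 ov.
have hx0 : gact h x0 != x0 by apply: contraTneq s2 => ->; rewrite s1.
pose tau (p : W) := match p with inl z => rho z | inr t => (rho y + sg t)%N end.
have tau_in t : tau (wedge_in y x0 t) = (rho y + sg t)%N.
  by rewrite /wedge_in; case: eqP => // ->; rewrite s1 addn0.
(* The word [w] brings [x] to the gluing point, and [h] then carries it to the top of the new
   block. *)
have top : wact (mk_letter h :: w) (inl x : W) = inr (gact h x0).
  by rewrite /= wE /= !eqxx /= conc_act_v /wedge_in (negPf hx0).
exists W, tau, (inl x); rewrite top; split.
- split=> // [_|[z|t]] /=; [lia|have := r3 z; lia|have := s3 t; lia].
- move=> i g p; have [iv|iv] := eqVneq i v; last first.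
    by rewrite /= wedge_act_neq //; case: p => [z|t] /=; rewrite ?r4 // leq_addr.
  move: g; rewrite iv => g; case: (wedge_cases y x0 p) => [[z zy ->]|[t ->]|->].
  - by have [] := wedge_act_v x0 vy g zy; rewrite /= => -> _; apply: r4.
  - by rewrite /= wedge_act_in !tau_in -addnA leq_add2l.
  - by rewrite /= eqxx leq_addr.
- split=> [k s /size_sum_split[u1 [u2 [U1 U2 -> h1 h2]]] sk|].
    have E1 : {in u1, forall z, rho z = k} by move=> z /h1 /sk.
    have E2 : {in u2, forall t, sg t = (k - rho y)%N}.
      by move=> t /h2 /sk /= <-; rewrite addKn.
    have B1 := r5 _ _ U1 E1; have B2 := s5 _ _ U2 E2.
    have [ky|ky|ky] := ltngtP k (rho y).
    (* Below the gluing height only [F] has points, above it only [X], and at that height the top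
       fiber of [F] and the bottom fiber of [X] meet. *)
    + suff -> : u2 = [::] by rewrite addn0.
      by case: (u2) h2 => // t u /(_ t (mem_head _ _)) /sk /=; lia.
    + suff -> : u1 = [::] by rewrite add0n; apply: leq_trans B2 _; lia.
      by case: (u1) E1 => // z u /(_ z (mem_head _ _)); have := r3 z; lia.
    + by have := r6 _ U1; rewrite -ky => /(_ E1); lia.
  move=> s /size_sum_split[u1 [u2 [U1 U2 -> h1 h2]]] sk.
  have -> : u1 = [::].
    by case: (u1) h1 => // z u /(_ z (mem_head _ _)) /sk /=; have := r3 z; lia.
  by apply: (s5 (sg (gact h x0))) U2 _ => t /h2 /sk /= /addnI.
- move=> i g; rewrite eq_sym (inj_eq Some_inj) => iv.
  by rewrite [LHS](wedge_act_neq _ _ _ _ iv).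
(* Before the last letter the path lies in [F], so it does not meet the new top and the condition
   holds vacuously. *)
- rewrite /= wE /=.
  have : avoids x y (commutes_last o) w by [].
  elim: (w) => [//|[i g] u IH] /= /andP[iok uok]; rewrite IH // andbT.
  by rewrite (wact_wedge_inl _ _ _ uok ov).
Qed.

(** The letters skipped since the last block commute with its vertex [j], so a further letter at [j]
    would be blocked. In a reduced word the next letter is thus at another vertex, and either
    [chain_commute] or [chain_wedge] applies. *)
Lemma reduced_chain w : reduced w ->
  exists2 o, chain o w & forall j, o = Some j -> blocked j w.
Proof.
elim: w => [_|[i g] w IH] /=; first by exists None => //; apply: chain_nil.
case/and3P=> g1 iw /IH[o ow oblk].
have [oi|oi] := boolP (commutes_last o i).
  case: o oi ow oblk => [j|//] oi ow /(_ j erefl) oblk; exists (Some j).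
    by apply: chain_commute => //; apply: contraTneq oblk => ->.
  by case/andP: oi => ij cij _ [<-]; rewrite -(c_sym ij) cij oblk orbT.
exists (Some i) => [|j [->]]; last by rewrite eqxx.
by apply: chain_wedge ow oi _ => //; apply: contraNneq iw => /oblk.
Qed.

Lemma separated_graph_product_cost : linearly_separated (2 * C)%N (graph_product c G).
Proof.
(* The cost must not depend on the element to be separated: one fixed representing word for each
   element serves for all chains. *)
exists (fun a => word_cost (repr (repr a))) => a a1.
have [w wa wmin] : exists2 w, gp_word w = a &
    forall w2, gp_word w2 = a -> (size w <= size w2)%N.
  pose P n := `[< exists2 w, gp_word w = a & size w = n >].
  have exP : exists n, P n.
    by have [w wa] := gp_word_repr a; exists (size w); apply/asboolP; exists w.
  case: (ex_minnP exP) => n /asboolP[w wa <-] wmin; exists w => // w2 w2a.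
  by apply: wmin; apply/asboolP; exists w2.
have w_red : reduced w by apply: shortest_reduced => w2; rewrite wa; apply: wmin.
have [o [F [rho [x [[r1 r2 r3] r4 [r5 _] _ _]]]] _] := reduced_chain w_red.
have aw : gp_act a x = wact w x by rewrite -wa gp_act_mk fp_act_word.
exists (gp_gset F), rho, x; rewrite /= aw; split=> //.
  by apply: r2; apply: contra_neq a1 => w0; rewrite -wa w0.
move=> b z; rewrite /gp_act /fp_act /word_cost; elim: (repr (repr b)) => [|l u IH] /=.
  by rewrite big_nil addn0.
by rewrite big_cons; apply: leq_trans (r4 _ _ _) _; lia.
Qed.

End Chains.

Lemma separated_graph_product (C : nat) :
  (0 < C)%N -> (forall i, linearly_separated C (G i)) ->
  linearly_separated (2 * C)%N (graph_product c G).
Proof.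
move=> C0 GC; apply: (@separated_graph_product_cost (fun i => projT1 (cid (GC i)))) => // i g.
exact: projT2 (cid (GC i)) g.
Qed.

End Families.

(** * Finite, abelian and cyclic groups *)

Section Regular.
Variable G : groupType.

Definition regular_gset : gset G := @GSet G G *%g (@mul1g G) (fun g h x => esym (mulgA g h x)).

End Regular.

(** The regular action, with height 0 at the identity and 1 elsewhere, serves every [g]. *)
Lemma separated_finite (G : groupType) :
  finite_set [set: G] -> exists C, linearly_separated C G.
Proof.
move=> /finite_seqP[r rG]; exists (size r), (fun=> 1%N) => g g1.
exists (regular_gset G), (fun z : G => (z != 1) : nat), 1; rewrite /= eqxx mulg1 g1.
split=> //.
- by move=> z; case: (z != 1).
- by move=> h z; case: (_ != 1); case: (_ != 1).
- move=> k s us _; apply: uniq_leq_size => // z _.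
  by have : [set: G] z by []; rewrite rG.
Qed.

(** * Rotations of finite cycles *)

Section Rotation.
Variable n : nat.
Implicit Types (z : 'I_n.+1) (m : int).

(** Only the additive group of ['I_n.+1] is used, so the one-point cycle [n = 0] is allowed; it
    occurs for the lamplighter group. *)
Definition rot1 : 'I_n.+1 := Zp1.

(** The distance to 0 on the cycle of length [n.+1]. *)
Definition circ_norm z : nat := minn z (n.+1 - z).

Lemma circ_normN z : circ_norm (- z)%R = circ_norm z.
Proof.
rewrite /circ_norm /=; have zn := ltn_ord z.
have [->|z0] := posnP z; first by rewrite subn0 modnn; lia.
by rewrite modn_small; lia.
Qed.

Lemma circ_norm_rot1 z : (circ_norm (z + rot1)%R <= circ_norm z + 1)%N.
Proof.
rewrite /circ_norm /= modnDmr; have zn := ltn_ord z.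
have [z1|z1] := ltnP (z + 1) n.+1; first by rewrite modn_small; lia.
have -> : (z + 1 = n.+1)%N by lia.
by rewrite modnn; lia.
Qed.

Lemma circ_norm_rot z m : (circ_norm (z + rot1 *~ m)%R <= circ_norm z + `|m|)%N.
Proof.
have pos k : forall t, (circ_norm (t + rot1 *+ k)%R <= circ_norm t + k)%N.
  elim: k => [|k IH] t; first by rewrite addr0 addn0.
  rewrite mulrS addrA; apply: leq_trans (IH _) _.
  by rewrite addnS -addSn leq_add2r -addn1 circ_norm_rot1.
case: m => k; first exact: pos.
by rewrite NegzE mulrNz -circ_normN opprD opprK -(circ_normN z) abszN; apply: pos.
Qed.

Lemma val_rot1_nat k : (rot1 *+ k)%R = (k %% n.+1)%N :> nat.
Proof. by elim: k => [|k IH]; rewrite ?mod0n // mulrS /= IH modnDm add1n. Qed.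

Lemma circ_norm_int m : (2 * `|m| <= n.+1)%N -> circ_norm (rot1 *~ m)%R = `|m|%N.
Proof.
have pos k : (2 * k <= n.+1)%N -> circ_norm (rot1 *+ k)%R = k.
  move=> kn; rewrite /circ_norm val_rot1_nat.
  have [->|k0] := posnP k; first by rewrite mod0n; lia.
  by case: n kn => [|n'] kn; [lia|rewrite modn_small; lia].
case: m => k kn; first exact: pos.
by rewrite NegzE mulrNz circ_normN abszN; apply: pos.
Qed.

Lemma circ_norm_fibers : fibers_le circ_norm 2.
Proof.
move=> k s us sk; apply: (@uniq_leq_size _ s [:: inord k; inord (n.+1 - k)]) => // z zs.
have := sk z zs; have zn := ltn_ord z; rewrite /circ_norm !inE => kE.
have [zk|zk] := leqP z (n.+1 - z).
  by apply/orP; left; apply/eqP/val_inj; rewrite /= inordK; lia.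
by apply/orP; right; apply/eqP/val_inj; rewrite /= inordK; lia.
Qed.

End Rotation.

Section IntegerMorphism.
Variables (G : groupType) (phi : G -> int).
Hypothesis phiM : {morph phi : x y / x * y >-> (x + y)%R}.

Lemma int_morph1 : phi 1 = 0%R.
Proof. by apply: (addrI (phi 1)); rewrite -phiM mulg1 addr0. Qed.

Section Action.
Variable n : nat.

Definition rot_act (g : G) (z : 'I_n.+1) : 'I_n.+1 := (z + rot1 n *~ phi g)%R.

Fact rot_act1 z : rot_act 1 z = z.
Proof. by rewrite /rot_act int_morph1 addr0. Qed.
Fact rot_actM g h z : rot_act (g * h) z = rot_act g (rot_act h z).
Proof. by rewrite /rot_act phiM mulrzDr -addrA [X in (z + X)%R]addrC. Qed.

Definition rot_gset : gset G := GSet rot_act1 rot_actM.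

End Action.

(** On the cycle of length [2 * |phi g|] the element [g] sends 0 to its antipode, the point of
    maximal height. *)
Lemma int_witness (g : G) :
  phi g != 0%R -> separation_witness (fun h => `|phi h|%N) 2 g.
Proof.
move=> g0; pose n := (2 * `|phi g|).-1.
have nE : n.+1 = (2 * `|phi g|)%N by rewrite prednK; lia.
have gx : circ_norm (rot_act g (0%R : 'I_n.+1)) = `|phi g|%N.
  by rewrite /rot_act add0r circ_norm_int // nE.
exists (rot_gset n), (@circ_norm n), 0%R; rewrite /= gx; split=> //.
- by rewrite /circ_norm /=; lia.
- by move=> z; move: (nE); rewrite /circ_norm; move: n.+1 (z : nat) => N k ->; lia.
- by move=> h z; apply: circ_norm_rot.
- exact: circ_norm_fibers.
Qed.

End IntegerMorphism.

(** * Finitely generated abelian groups *)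

Section IntPower.
Variables (G : groupType) (x : G).

Definition zpow (k : int) : G := if k is Negz n then x ^- n.+1 else x ^+ `|k|.

Lemma zpowS k : zpow (k + 1)%R = zpow k * x.
Proof.
case: k => [n|[|n]].
- by rewrite -PoszD addn1 /= expgSr.
- by rewrite /= expg1 mulVg.
- have -> : (Negz n.+1 + 1 = Negz n)%R by lia.
  by rewrite [zpow (Negz n.+1)]/= [x ^+ n.+2]expgS invgM -mulgA mulVg mulg1.
Qed.

Lemma zpowM : {morph zpow : a b / (a + b)%R >-> a * b}.
Proof.
have zpowP k : zpow (k - 1)%R = zpow k * x^-1.
  by rewrite -[k in RHS](subrK 1%R) zpowS mulgK.
move=> a b; elim: b => [|n IH|n IH]; first by rewrite addr0 mulg1.
  by rewrite -addn1 PoszD addrA !zpowS IH mulgA.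
by rewrite -addn1 PoszD opprD addrA !zpowP IH mulgA.
Qed.

Lemma zpowN k : zpow (- k)%R = (zpow k)^-1.
Proof. by apply: (@mulgI _ (zpow k)); rewrite -zpowM subrr mulgV. Qed.

End IntPower.

Lemma generated_cons_abelian (A : groupType) (t : A) (s : seq A) (a : A) :
  (forall x y : A, x * y = y * x) -> generated [set` t :: s] a ->
  exists h k, generated [set` s] h /\ a = h * zpow t k.
Proof.
move=> mulC; have [s1 sM sV] := generated_subgroup [set` s].
move=> /(_ [set x | exists h k, generated [set` s] h /\ x = h * zpow t k]).
apply; split=> [|x]; first split.
- by exists 1, 0%R; rewrite mulg1.
- move=> _ _ [h [k [sh ->]]] [h' [k' [sh' ->]]]; exists (h * h'), (k + k')%R.
  split; first exact: sM.
  by rewrite zpowM -!mulgA; congr (_ * _); rewrite mulgA (mulC _ h') mulgA.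
- move=> _ [h [k [sh ->]]]; exists h^-1, (- k)%R.
  by split; [exact: sV|rewrite invgM zpowN mulC].
rewrite /= inE => /orP[/eqP ->|xs].
  by exists 1, 1%R; rewrite mul1g.
exists x, 0%R; rewrite mulg1; split=> //.
by move=> H [_]; apply.
Qed.

Lemma generatedX (A : groupType) (S : set A) (a : A) n :
  generated S a -> generated S (a ^+ n).
Proof.
have [S1 SM _] := generated_subgroup S.
by move=> Sa; elim: n => [|n IH] //; rewrite expgS; apply: SM.
Qed.

Section Abelian.
Variable A : groupType.
Hypothesis mulC : (forall x y : A, x * y = y * x).

Lemma generated_zpow_torsion (s : seq A) (t : A) (k : int) :
  (forall n, (0 < n)%N -> ~ generated [set` s] (t ^+ n)) ->
  generated [set` s] (zpow t k) -> k = 0%R.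
Proof.
have [_ _ sV] := generated_subgroup [set` s].
move=> tor; case: k => [[|n]|n] //= ts; first by case: (tor n.+1).
by case: (tor n.+1) => //; rewrite -[_ ^+ _]invgK; apply: sV.
Qed.

(** Induction on the generators. If a power [t ^+ n] lies in the span of [s], the morphisms are
    composed with the [n]-th power map; otherwise [t] spans a free direct factor, and the exponent
    of [t] is one more morphism. A single [M] bounds all the morphisms. *)
Lemma abelian_int_morphisms (s : seq A) : exists2 N, (0 < N)%N &
  exists M : A -> nat, forall g, generated [set` s] g -> g ^+ N != 1 ->
    exists phi : A -> int, [/\ phi g != 0%R,
      forall a b, generated [set` s] a -> generated [set` s] b ->
        phi (a * b) = (phi a + phi b)%R
    & forall h, (`|phi h| <= M h)%N].
Proof.
elim: s => [|t s [N N0 [M HM]]].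
  exists 1%N => //; exists (fun=> 0%N) => g /(_ [set 1]) -> ; first by rewrite expg1n eqxx.
  by split=> //; split=> // [x y -> ->|x ->]; rewrite ?mulg1 ?invg1.
have [s1 sM sV] := generated_subgroup [set` s].
have dec a : generated [set` t :: s] a -> _ := generated_cons_abelian mulC.
have [[n n0 tn]|tor] := pselect (exists2 n, (0 < n)%N & generated [set` s] (t ^+ n)).
  have gn a : generated [set` t :: s] a -> generated [set` s] (a ^+ n).
    move=> /dec[h [k [sh ->]]]; rewrite expgMn; last exact: mulC.
    apply: sM; first exact: generatedX.
    have : generated [set` s] (zpow (t ^+ n) k).
      by case: k => k /=; [|apply: sV]; apply: generatedX.
    by case: k => k /=; rewrite ?expVgn -!expgnA mulnC.
  exists (n * N)%N; first by rewrite muln_gt0 n0.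
  exists (fun h => M (h ^+ n)) => g /gn tg; rewrite expgnA => /(HM _ tg)[phi [p1 p2 p3]].
  exists (fun a => phi (a ^+ n)); split=> // a b /gn ta /gn tb.
  by rewrite expgMn ?p2 //; apply: mulC.
have {}tor m : (0 < m)%N -> ~ generated [set` s] (t ^+ m).
  by move=> m0 tm; apply: tor; exists m.
have uniq_dec h h' k k' : generated [set` s] h -> generated [set` s] h' ->
    h * zpow t k = h' * zpow t k' -> k = k' /\ h = h'.
  move=> sh sh' E; have kk' : (k - k' = 0)%R.
    apply: (generated_zpow_torsion tor); rewrite zpowM zpowN.
    have -> : zpow t k = h^-1 * (h' * zpow t k') by rewrite -E mulKg.
    by rewrite -mulgA mulgK; apply: sM => //; apply: sV.
  have {}kk' : k = k' by apply/eqP; rewrite -subr_eq0 kk'.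
  by split=> //; move: E; rewrite kk' => /mulIg.
(* The decomposition as a total function; its value [(1, 0)] outside the span is arbitrary. *)
have /choice[f fP] : forall a, exists hk : A * int, generated [set` t :: s] a ->
    generated [set` s] hk.1 /\ a = hk.1 * zpow t hk.2.
  move=> a; have [/dec[h [k hk]]|] := pselect (generated [set` t :: s] a).
    by exists (h, k).
  by exists (1, 0%R).
have [_ tM _] := generated_subgroup [set` t :: s].
have fM a b : generated [set` t :: s] a -> generated [set` t :: s] b ->
    (f (a * b)).2 = ((f a).2 + (f b).2)%R /\ (f (a * b)).1 = (f a).1 * (f b).1.
  move=> ta tb; have [sa aE] := fP _ ta; have [sb bE] := fP _ tb.
  have [sab abE] := fP _ (tM _ _ ta tb).
  apply: uniq_dec => //; first exact: sM.
  rewrite -abE zpowM {1}aE {1}bE -!mulgA; congr (_ * _).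
  by rewrite !mulgA (mulC _ (f b).1).
exists N => //; exists (fun h => `|(f h).2| + M (f h).1)%N => g tg gN.
have [sg gE] := fP _ tg.
have [k0|k0] := eqVneq (f g).2 0%R; last first.
  exists (fun a => (f a).2); split=> // [a b ta tb|h]; last exact: leq_addr.
  by have [] := fM a b ta tb.
have gE' : g = (f g).1 by rewrite {1}gE k0 mulg1.
have [|phi [p1 p2 p3]] := HM _ sg; first by rewrite -gE'.
exists (fun a => phi (f a).1); split=> // [a b ta tb|h].
  have [_ ->] := fM a b ta tb; apply: p2; [by case: (fP _ ta)|by case: (fP _ tb)].
by apply: leq_trans (p3 _) _; rewrite leq_addl.
Qed.

(** Exponents are reduced modulo [N], so the cosets of the [N]-th powers are finitely many. *)
Lemma abelian_mod_powers (s : seq A) (N : nat) : (0 < N)%N -> exists E : seq A,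
  forall a, generated [set` s] a -> exists2 e, e \in E & exists b, a = e * b ^+ N.
Proof.
move=> N0; elim: s => [|t s [E HE]].
  exists [:: 1] => a /(_ [set 1]) ->; first by
    exists 1; rewrite ?inE //; exists 1; rewrite expg1n mulg1.
  by split=> //; split=> // [x y -> ->|x ->]; rewrite ?mulg1 ?invg1.
exists [seq e * t ^+ r | e <- E, r <- iota 0 N] => a.
case/(generated_cons_abelian mulC) => h [k [/HE[e eE [b ->]] ->]].
exists (e * t ^+ `|(k %% N)%Z|).
  apply: allpairs_f => //; rewrite mem_iota add0n /=.
  have := ltz_pmod k (d := N); have := modz_ge0 k (d := N); lia.
exists (b * zpow t (k %/ N)%Z); rewrite expgMn; last exact: mulC.
have -> : zpow t k = zpow t (k %/ N)%Z ^+ N * t ^+ `|(k %% N)%Z|.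
  rewrite {1}(divz_eq k N) zpowM; congr (_ * _); last first.
    by rewrite -[t ^+ _]/(zpow t `|(k %% N)%Z|%N) gez0_abs // modz_ge0; lia.
  move: (k %/ N)%Z => q; elim: (N) => [|n IH]; first by rewrite mulr0.
  by rewrite expgS -addn1 PoszD mulrDr mulr1 addrC zpowM IH.
rewrite -!mulgA; congr (_ * _); rewrite mulgA mulC; congr (_ * _).
Qed.

Definition powers (N : nat) : set A := range (fun b : A => b ^+ N).

Lemma powers_normal (N : nat) : is_normal_subgroup (powers N).
Proof.
split; first split.
- by exists 1; rewrite ?expg1n.
- by move=> _ _ [a _ <-] [b _ <-]; exists (a * b); rewrite ?expgMn //; apply: mulC.
- by move=> _ [a _ <-]; exists a^-1; rewrite ?expVgn.
- by move=> x g xN; rewrite conjgE (mulC x) mulKg.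
Qed.

(** If no bounded morphism to the integers detects [g], then [g] is not an [N]-th power: for
    [g = b ^+ N] a morphism nonzero on [b] would be nonzero on [g]. Hence [g] survives in the finite
    quotient by [N]-th powers. *)
Lemma separated_abelian : fin_gen [set: A] -> exists C, linearly_separated C A.
Proof.
case=> s sA; have gen a : generated [set` s] a by rewrite -sA.
have [N N0 [M HM]] := abelian_int_morphisms s.
have [E HE] := abelian_mod_powers s N0.
pose Q := quotient_group (powers N).
have [C [MQ HQ]] : exists C, linearly_separated C Q.
  apply: separated_finite; apply: (@sub_finite_set _ _ [set` map (quo_mk (powers N)) E]) => //.
  move=> q _; have [e eE [b ab]] := HE (repr q) (gen _).
  apply/mapP; exists e => //; rewrite -[LHS]quo_mkK ab; apply/esym/quo_mkP.
  by rewrite mulKg => H [_]; apply; exists b.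
exists (maxn 2 C), (fun h => M h + MQ (quo_mk (powers N) h))%N => g g1.
have [[phi [p1 p2 p3]]|nphi] := pselect (exists phi : A -> int, [/\ phi g != 0%R,
    {morph phi : x y / x * y >-> (x + y)%R} & forall h, (`|phi h| <= M h)%N]).
  have := int_witness p2 p1; apply: separation_witnessW; last exact: leq_maxl.
  by move=> h; apply: leq_trans (p3 h) _; apply: leq_addr.
have: separation_witness (MQ \o quo_mk (powers N)) C g.
  apply: separation_witness_pull; first exact: quo_mk_morph.
  apply: HQ; apply/eqP => /esym /quo_mkP; rewrite invg1 mul1g.
  move=> /(_ (powers N))[]; first by split=> //; apply: powers_normal.
  move=> b _ bg; apply: nphi.
  have [|phi [p1 p2 p3]] := HM b (gen b); first by rewrite bg.
  have phiM : {morph phi : x y / x * y >-> (x + y)%R} by move=> x y; apply: p2.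
  exists phi; split=> //; rewrite -bg; elim: (N) N0 => // -[|n] IH _.
    by rewrite expg1.
  rewrite expgS phiM.
  have : forall m, phi (b ^+ m) = (phi b *+ m)%R.
    elim=> [|m IHm]; first by rewrite (int_morph1 phiM).
    by rewrite expgS phiM IHm mulrS.
  move=> ->; rewrite -mulrS; lia.
apply: separation_witnessW; [by move=> h; apply: leq_addl|exact: leq_maxr].
Qed.

End Abelian.

Lemma separated_infinite_cyclic (A : groupType) :
  infinite_cyclic A -> linearly_separated 2 A.
Proof.
case=> infA [g gA].
have zg a : exists k, a = zpow g k.
  have : generated [set g] a by rewrite gA.
  move=> /(_ [set a | exists k, a = zpow g k]); apply; split=> [|_ ->]; last first.
    by exists 1%R.
  split=> [|_ _ [k ->] [l ->]|_ [k ->]]; first by exists 0%R.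
    by exists (k + l)%R; rewrite zpowM.
  by exists (- k)%R; rewrite zpowN.
(* A trivial power of [g] would leave only finitely many elements. *)
have g_tor n : (0 < n)%N -> g ^+ n != 1.
  move=> n0; apply/eqP => gn; apply: infA.
  apply: (@sub_finite_set _ _ [set` [seq g ^+ r | r <- iota 0 n]]) => // a _.
  have [k ->] := zg a; apply/mapP; exists `|(k %% n)%Z|%N.
    rewrite mem_iota add0n /=.
    by have := ltz_pmod k (d := n); have := modz_ge0 k (d := n); lia.
  have gq q : zpow g (q * n%:Z)%R = 1.
    have gn0 m : zpow g (m%:Z * n%:Z)%R = 1 by rewrite -PoszM mulnC /= expgnA gn expg1n.
    by case: q => m; rewrite ?NegzE ?mulNr ?zpowN gn0 ?invg1.
  rewrite {1}(divz_eq k n) zpowM gq mul1g.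
  rewrite -[g ^+ _]/(zpow g `|(k %% n)%Z|%N) gez0_abs//.
  by rewrite modz_ge0; lia.
have zinj : injective (zpow g).
  move=> k l kl; apply/eqP; rewrite -subr_eq0.
  have : zpow g (k - l)%R = 1 by rewrite zpowM zpowN kl mulgV.
  case: (k - l)%R => [[|n]|n] //= /eqP; first by rewrite (negPf (g_tor _ _)).
  by rewrite invg_eq1 (negPf (g_tor _ _)).
have [phi phiP] := choice zg.
have phiM : {morph phi : x y / x * y >-> (x + y)%R}.
  by move=> x y; apply: zinj; rewrite zpowM -!phiP.
exists (fun h => `|phi h|%N) => x x1; apply: int_witness => //.
by apply: contraNneq x1 => p0; rewrite (phiP x) p0.
Qed.

(** * The Grigorchuk group *)

Inductive grig_letter := LA | LB | LC | LD.

Definition grig_fun (l : grig_letter) : seq bool -> seq bool :=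
  match l with LA => fun_a | LB => fun_b | LC => fun_c | LD => fun_d end.

Definition grig_word (ws : seq grig_letter) (w : seq bool) : seq bool :=
  foldr grig_fun w ws.

Lemma grig_word_cat ws ws' w : grig_word (ws ++ ws') w = grig_word ws (grig_word ws' w).
Proof. exact: foldr_cat. Qed.

Lemma grig_funK l : involutive (grig_fun l).
Proof. by case: l; [exact: fun_aK|exact: fun_bK|exact: fun_cK|exact: fun_dK]. Qed.

Lemma size_fun_a w : size (fun_a w) = size w.
Proof. by case: w. Qed.

Lemma size_grig_fun l w : size (grig_fun l w) = size w.
Proof.
case: l; first exact: size_fun_a.
all: suff h : [/\ size (fun_b w) = size w, size (fun_c w) = size w
               & size (fun_d w) = size w] by case: h.
all: elim: w => [//|[] w [hb hc hd]] /=; rewrite ?size_fun_a ?hb ?hc ?hd //.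
Qed.

Lemma size_grig_word ws w : size (grig_word ws w) = size w.
Proof. by elim: ws => //= l ws IH; rewrite size_grig_fun. Qed.

Lemma grig_word_inj ws : injective (grig_word ws).
Proof. by elim: ws => //= l ws IH w w' /(can_inj (grig_funK l)) /IH. Qed.

(** The generators are involutions, so reversing a word inverts it. *)
Lemma Grigorchuk_word (f : tree_aut) :
  Grigorchuk_group f -> exists ws, f =1 grig_word ws.
Proof.
have K g ws : g =1 grig_word ws -> cancel g (grig_word (rev ws)).
  move=> gE w; rewrite gE; elim: ws w {gE} => //= l ws IH w.
  by rewrite rev_cons -cats1 grig_word_cat /= grig_funK.
move=> /(_ [set f : tree_aut | exists ws, f =1 grig_word ws]); apply; split; first split.
- by exists [::].
- move=> f1 f2 [w1 E1] [w2 E2]; exists (w1 ++ w2) => w.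
  by rewrite grig_word_cat /= E1 E2.
- move=> g [ws gE]; exists (rev ws) => w; rewrite -{2}(tree_funKV g w).
  by rewrite (K g ws gE).
move=> g /=; rewrite !inE => /or4P[] /eqP ->.
- by exists [:: LA].
- by exists [:: LB].
- by exists [:: LC].
- by exists [:: LD].
Qed.

(* The position of a word on the Schreier graph of its level, which is a
   segment: a Gray code, the first letter being the least significant. *)
Fixpoint gray (w : seq bool) : nat :=
  if w is x :: w' then (gray w').*2 + (~~ x (+) odd (gray w')) else 0.

Lemma gray_half x w : (gray (x :: w))./2 = gray w.
Proof. by rewrite /= addnC half_bit_double. Qed.

Lemma gray_lt w : (gray w < 2 ^ size w)%N.
Proof.
elim: w => [//|x w IH] /=; rewrite expnS.
by case: (_ (+) _); lia.
Qed.

Lemma gray_inj w w' : size w = size w' -> gray w = gray w' -> w = w'.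
Proof.
elim: w w' => [|x w IH] [|x' w'] //= [sw] E.
have ww' : w = w'.
  by apply: IH => //; rewrite -(gray_half x w) -(gray_half x' w') /= E.
rewrite ww' in E *; congr (_ :: _); move: E.
by move/addnI; case: x x' (odd _) => [] [] [].
Qed.

Lemma gray_fun_a x w : gray (fun_a (x :: w)) =
  if odd (gray (x :: w)) then (gray (x :: w)).-1 else (gray (x :: w)).+1.
Proof.
by rewrite /= oddD odd_double oddb; case: x (odd (gray w)) => [] []; rewrite /= ?addn0 ?addn1.
Qed.

(** Staying put or crossing an edge from [2q - 1] to [2q], as b, c and d do, whereas a crosses those
    from [2q] to [2q + 1]. As [0.-1] is 0, the end 0 carries a loop. *)
Definition odd_step (p q : nat) : bool := (q == p) || (q == if odd p then p.+1 else p.-1).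

(** A leading [true] preserves such steps, and a leading [false] turns a step of a into one,
    matching the recursion for b, c and d. *)
Lemma gray_bcd w : [/\ odd_step (gray w) (gray (fun_b w)),
  odd_step (gray w) (gray (fun_c w)) & odd_step (gray w) (gray (fun_d w))].
Proof.
have st_a w' : odd_step (gray (false :: w')) (gray (false :: fun_a w')).
  case: w' => [//|x w']; move: (gray_fun_a x w'); move: (x :: w') => v gE.
  rewrite /odd_step /= gE oddD odd_double; move: (gray v) => p.
  by case: ifP => op; rewrite /= ?op /=; lia.
have st_t w' w'' : odd_step (gray w') (gray w'') ->
    odd_step (gray (true :: w')) (gray (true :: w'')).
  rewrite /odd_step /= => /orP[/eqP ->|/eqP ->]; first by rewrite eqxx.
  by rewrite oddD odd_double; case: ifP => op; rewrite /= ?op /=; lia.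
elim: w => [//|[] w [hb hc hd]] /=; split; try exact: st_a; try exact: st_t.
by rewrite /odd_step eqxx.
Qed.

Lemma gray_grig_fun l w : (dist (gray (grig_fun l w)) (gray w) <= 1)%N.
Proof.
have step p q : odd_step p q -> (dist q p <= 1)%N.
  by rewrite /odd_step /dist; case: ifP => op /orP[] /eqP ->; lia.
have [hb hc hd] := gray_bcd w.
case: l; [|exact: step..].
by case: w {hb hc hd} => // x w; rewrite gray_fun_a /dist; case: ifP; lia.
Qed.

Lemma gray_grig_word ws w : (gray (grig_word ws w) <= gray w + size ws)%N.
Proof.
elim: ws => [|l ws IH] /=; first by rewrite addn0.
by have := gray_grig_fun l (grig_word ws w); rewrite /dist; lia.
Qed.

(** Flipping the last, most significant letter reflects the segment. *)
Lemma gray_rcons u : (gray (rcons u false) + gray (rcons u true)).+1 = (2 ^ (size u).+1)%N.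
Proof.
elim: u => [//|x u IH]; rewrite rcons_cons /= expnS -IH.
have : odd (gray (rcons u false)) = ~~ odd (gray (rcons u true)).
  have : odd (2 ^ (size u).+1) = false by rewrite oddX.
  by rewrite -IH /= oddD; case: (odd _) (odd _) => [] [].
by move=> ->; case: x (odd _) => [] []; rewrite /=; lia.
Qed.

Lemma gray_rcons_true u : gray (rcons u true) = gray u.
Proof. by elim: u => //= x u ->. Qed.

Lemma gray_cat z x : (gray (z ++ x) < 2 ^ size z * (gray x).+1)%N.
Proof.
elim: z => [|b z IH] /=; first by rewrite mul1n.
by rewrite expnS; case: (_ (+) _); lia.
Qed.

Lemma grig_word_edge ws u x : exists y, grig_word ws (rcons u x) = rcons (grig_word ws u) y.
Proof.
elim: ws x => [|l ws IH] x /=; first by exists x.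
have [y ->] := IH x; case: l.
- exact: fun_a_edge.
- exact: fun_b_edge.
- exact: fun_c_edge.
- exact: fun_d_edge.
Qed.

(* Whether [ws] swaps the two children of [u]. *)
Definition active ws u : bool := last false (grig_word ws (rcons u false)).

Lemma grig_word_rcons ws u x :
  grig_word ws (rcons u x) = rcons (grig_word ws u) (x (+) active ws u).
Proof.
have [y0 E0] := grig_word_edge ws u false; have [y1 E1] := grig_word_edge ws u true.
rewrite /active E0 last_rcons; case: x => //; rewrite E1; congr rcons.
have : y1 != y0.
  apply/eqP => y10; have : rcons u true = rcons u false.
    by apply: (@grig_word_inj ws); rewrite E0 E1 y10.
  by move/rcons_inj.
by case: (y0) (y1) => [] [].
Qed.

Lemma active_cons l ws u : active (l :: ws) u = active [:: l] (grig_word ws u) (+) active ws u.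
Proof.
rewrite {1}/active /= grig_word_rcons.
by have := grig_word_rcons [:: l] (grig_word ws u) (active ws u) => /= ->; rewrite last_rcons addbC.
Qed.

Fixpoint words (n : nat) : seq (seq bool) :=
  if n is m.+1 then [seq x :: w | x <- [:: false; true], w <- words m] else [:: [::]].

Lemma mem_words n w : (w \in words n) = (size w == n).
Proof.
elim: n w => [|n IH] [|x w] //=.
  by apply/negbTE/negP; rewrite mem_cat => /orP[] => [/mapP[]|]; rewrite ?cats0 // => /mapP[].
rewrite cats0 eqSS -IH mem_cat.
have cons_inj (b : bool) : injective (cons b) by move=> ? ? [].
case: x; rewrite (mem_map (@cons_inj _)).
  by case: mapP => // -[].
by case: (mapP (f := cons true)) => [[]|] //; rewrite orbF.
Qed.

Definition low_words := words 1 ++ words 2 ++ words 3.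

Lemma mem_low_words w : (w \in low_words) = (0 < size w <= 3)%N.
Proof.
have catE (s t r : seq (seq bool)) : (w \in s ++ t ++ r) = [|| w \in s, w \in t | w \in r].
  by rewrite !mem_cat.
by rewrite /low_words catE !mem_words; lia.
Qed.

Lemma perm_low_words ws : perm_eq [seq grig_word ws u | u <- low_words] low_words.
Proof.
have u_low : uniq low_words by [].
have u_map : uniq [seq grig_word ws u | u <- low_words].
  by rewrite map_inj_uniq //; apply: grig_word_inj.
apply: uniq_perm => //; apply: (uniq_min_size u_map _ _).2; last by rewrite size_map.
by move=> _ /mapP[u ul ->]; rewrite mem_low_words size_grig_word -mem_low_words.
Qed.

(* The numbers of active vertices at levels 1, 2 and 3 are homomorphisms to Z/2
   on tree automorphisms, and their sum vanishes on a, b, c and d. *)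
Lemma parity_low_words ws : \big[addb/false]_(u <- low_words) active ws u = false.
Proof.
elim: ws => [|l ws IH].
  by rewrite big1_seq // => u _; rewrite /active last_rcons.
under eq_bigr do rewrite active_cons.
rewrite big_split /= IH addbF -(big_map (grig_word ws) xpredT (active [:: l])).
(* For a single letter: a is active only at the root, which is left out, and each of b, c, d is
   active at exactly two of 0, 10, 110. *)
by rewrite (perm_big _ (perm_low_words ws)) /low_words unlock; case: l.
Qed.

(** Levels 1 and 2 contribute nothing to the parity, so the number of active words of length 3 is
    even. *)
Lemma active_other ws x :
  (forall u, (size u <= 3)%N -> grig_word ws u = u) -> size x = 3%N -> active ws x ->
  exists x', [/\ size x' = 3%N, x' != x & active ws x'].
Proof.
move=> ws1 x3 ax; apply: contrapT => no.
have := parity_low_words ws; rewrite (bigD1_seq x) ?mem_low_words ?x3 //= ax.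
rewrite big_seq_cond big1 // => u /andP[]; rewrite mem_low_words => /andP[_ u3] ux.
have [us|us] := eqVneq (size u) 3%N.
  by apply/negbTE/negP => au; apply: no; exists u.
by rewrite /active ws1 ?last_rcons // size_rcons ltn_neqAle us.
Qed.

(** Self-similarity: below any vertex a generator acts by a generator or trivially. *)
Lemma grig_fun_section l z : exists ws', forall v,
  grig_fun l (z ++ v) = grig_fun l z ++ grig_word ws' v.
Proof.
elim: z l => [|x z IH] l.
  by exists [:: l] => v; case: l.
case: l => /=; first by exists [::].
all: case: x.
- by have [ws' E] := IH LC; exists ws' => v; have /= -> := E v.
- by case: z {IH} => [|y z]; [exists [:: LA]|exists [::]].
- by have [ws' E] := IH LD; exists ws' => v; have /= -> := E v.
- by case: z {IH} => [|y z]; [exists [:: LA]|exists [::]].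
- by have [ws' E] := IH LB; exists ws' => v; have /= -> := E v.
- by exists [::].
Qed.

Lemma grig_word_section ws z : exists ws', forall v,
  grig_word ws (z ++ v) = grig_word ws z ++ grig_word ws' v.
Proof.
elim: ws => [|l ws [w1 E1]]; first by exists [::].
have [w2 E2] := grig_fun_section l (grig_word ws z).
by exists (w2 ++ w1) => v; rewrite /= E1 E2 grig_word_cat.
Qed.

(* Let [n] be the first level on which [ws] acts nontrivially.  It swaps the
   children of some [u] of length [n - 1], which are adjacent when [u] lies at an
   end of its level; but by parity [ws] also swaps the children of another word
   with the same first [n - 4] letters, and this one is far from that end. *)
Lemma grig_word_far ws w0 : grig_word ws w0 != w0 ->
  exists2 w, (0 < dist (gray (grig_word ws w)) (gray w))%N &
    (2 ^ size w <= 8 * dist (gray (grig_word ws w)) (gray w))%N.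
Proof.
move=> mv0; pose P n := `[< exists2 w, size w = n & grig_word ws w != w >].
have exP : exists n, P n by exists (size w0); apply/asboolP; exists w0.
case: (ex_minnP exP) => n /asboolP[w sw mv] nmin.
have fixed u : (size u < n)%N -> grig_word ws u = u.
  move=> un; apply: contraTeq un => mvu; rewrite -leqNgt; apply: nmin.
  by apply/asboolP; exists u.
have dist_pos v : grig_word ws v != v -> (0 < dist (gray (grig_word ws v)) (gray v))%N.
  move=> mvv; have : gray (grig_word ws v) != gray v.
    by apply: contra_neq mvv => /gray_inj; apply; rewrite size_grig_word.
  by rewrite /dist; lia.
have [n3|n3] := leqP n 3.
  exists w; first exact: dist_pos.
  rewrite sw; have := dist_pos w mv; have : (2 ^ n <= 2 ^ 3)%N by rewrite leq_exp2l.
  by move: (2 ^ n)%N; rewrite (_ : 2 ^ 3 = 8)%N //; lia.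
case/lastP: w sw mv => [|u x]; first by move=> /= n0; rewrite -n0 in n3.
rewrite size_rcons => sn mv.
have act_u : active ws u.
  by apply: contraNT mv => /negbTE au; rewrite grig_word_rcons au addbF fixed // -sn.
pose z := take (n - 4) u; pose y := drop (n - 4) u.
have uE : u = z ++ y by rewrite cat_take_drop.
have sz : size z = (n - 4)%N by rewrite size_take; case: ifP; lia.
have sy : size y = 3%N by rewrite size_drop; lia.
have [ws' wsE] := grig_word_section ws z.
have ws'1 v : (size v <= 3)%N -> grig_word ws' v = v.
  move=> v3; have : z ++ grig_word ws' v = z ++ v.
    by rewrite -{1}(fixed z) ?sz -?wsE ?fixed ?size_cat ?sz //; lia.
  by move/eqP; rewrite eqseq_cat // eqxx => /eqP.
have act_z v : size v = 3%N -> active ws (z ++ v) = active ws' v.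
  move=> v3; rewrite /active rcons_cat wsE last_cat !grig_word_rcons !last_rcons.
  by [].
have act_y : active ws' y by rewrite -act_z // -uE.
have [y' [sy' yy' act_y']] := active_other ws'1 sy act_y.
(* Two distinct words of length 3 cannot both be at position 7, the bad end. *)
have [v [v3 act_v gv]] : exists v, [/\ size v = 3%N, active ws' v & (gray v <= 6)%N].
  have := gray_lt y; have := gray_lt y'; rewrite sy sy' => g' g.
  have : gray y' != gray y by apply: contra_neq yy' => /gray_inj; apply; rewrite sy sy'.
  move=> gg; have [gy|gy] := leqP (gray y) 6; first by exists y.
  by exists y'; split=> //; move: g g' gg gy; rewrite (_ : 2 ^ 3 = 8)%N //; lia.
have szv : size (z ++ v) = n.-1 by rewrite size_cat sz v3; lia.
have mvv : grig_word ws (rcons (z ++ v) false) = rcons (z ++ v) true.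
  by rewrite grig_word_rcons act_z // act_v fixed // szv; lia.
exists (rcons (z ++ v) false).
  by apply: dist_pos; rewrite mvv; apply/eqP => /rcons_inj.
(* With [q = 2 ^ (n - 4)], the lower child is before [7q] on a segment of [16q] points and the other
   child is its mirror image, so their distance exceeds [2q]. *)
rewrite mvv size_rcons szv; have := gray_rcons (z ++ v); rewrite gray_rcons_true szv.
have := gray_cat z v; rewrite sz (_ : n.-1.+1 = (n - 4) + 4)%N; last by lia.
rewrite expnD (_ : 2 ^ 4 = 16)%N // /dist; move: (2 ^ (n - 4))%N => q.
move: (gray (z ++ v)) (gray (rcons _ _)) => p1 p0.
by nia.
Qed.

Lemma size_tree_aut (f : tree_aut) w : size (f w) = size w.
Proof.
elim/last_ind: w => [|w x IH]; first by rewrite tree_root.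
by have [y ->] := tree_edge f w x; rewrite !size_rcons IH.
Qed.

Section LevelAction.
Variable n : nat.

Lemma level_size (f : tree_aut) (t : n.-tuple bool) : size (f t) == n.
Proof. by rewrite size_tree_aut size_tuple. Qed.

Definition level_act (f : tree_aut) (t : n.-tuple bool) : n.-tuple bool :=
  Tuple (level_size f t).

Fact level_act1 t : level_act 1 t = t.
Proof. exact: val_inj. Qed.
Fact level_actM f g t : level_act (f * g) t = level_act f (level_act g t).
Proof. exact: val_inj. Qed.

Definition level_gset : gset tree_aut := GSet level_act1 level_actM.

End LevelAction.

Lemma separated_Grigorchuk (G : groupType) :
  isog_onto G Grigorchuk_group -> exists C, linearly_separated C G.
Proof.
case=> f [finj fG]; have fM : {morph f : x y / x * y} by apply: gmulfM.
have /choice[W WP] : forall g, exists ws, f g =1 grig_word ws.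
  by move=> g; apply: Grigorchuk_word; rewrite -fG; exists g.
(* The constant of [fold_witness] for [K = 8] and fibers of size 1. *)
exists (4 * 9 * 1)%N, (fun g => size (W g) + size (W g^-1))%N => g g1.
have [w0 mv] : exists w0, grig_word (W g) w0 != w0.
  apply: contrapT => no; case/eqP: g1; apply: finj; rewrite (morph_1 fM).
  by apply: tree_autP => w; rewrite WP; apply/eqP/contraT => mv; case: no; exists w.
have [w d0 d8] := grig_word_far mv.
apply: (@fold_witness G (fun g => size (W g)) 1 8 (2 ^ size w) g
  (pull_gset fM (level_gset (size w))) (fun t => gray (tval t)) (in_tuple w)).
- by move=> z; have := gray_lt z; rewrite size_tuple; apply: ltnW.
- by rewrite /= WP.
- by rewrite /= WP.
- by move=> h z; rewrite /= WP gray_grig_word.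
- move=> k s us sk.
  case: s us sk => [|a [|b s]] //=; rewrite inE negb_or => /andP[/andP[/eqP ab _] _] sk.
  case: ab; apply: val_inj; apply: gray_inj; rewrite ?size_tuple //.
  by rewrite !sk ?inE ?eqxx ?orbT.
Qed.

(** * Lamplighter groups *)

Lemma rot1_eq0 (n : nat) (m : int) : (rot1 n *~ m = 0)%R -> (`|m| <= n)%N -> m = 0%R.
Proof.
have pos k : (rot1 n *+ k = 0)%R -> (k <= n)%N -> k = 0%N.
  move=> /(congr1 val) /=; rewrite val_rot1_nat => + kn.
  by rewrite modn_small // ltnS.
case: m => k /= mE kn; first by rewrite (pos k).
move: mE; rewrite NegzE mulrNz => /eqP; rewrite oppr_eq0 => /eqP /pos.
by move=> /(_ kn).
Qed.

Section LamplighterAction.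
Variables (p n : nat).
Implicit Types s t : lamplighter p.

Definition over (j : 'I_n.+1) : pred int := fun k => (rot1 n *~ k)%R == j.

(** The push-forward of the lamp configuration to the cycle: lamps over the same residue are
    added. *)
Definition fold_lamp s (j : 'I_n.+1) : 'Z_p := (\sum_(k \in [set` over j]) lamp s k)%R.

Lemma fold_lampE s (r : seq int) j :
  uniq r -> (forall k, lamp s k != 0%R -> k \in r) ->
  fold_lamp s j = (\sum_(k <- r | over j k) lamp s k)%R.
Proof.
move=> ur sr; apply/esym/bigfs => // k _ kr.
by apply: contraNeq kr => /sr.
Qed.

Lemma lamp_support s : exists2 r : seq int, uniq r & forall k, lamp s k != 0%R -> k \in r.
Proof.
have /finite_seqP[r rE] := lamp_finite s; exists (undup r); rewrite ?undup_uniq // => k sk.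
by rewrite mem_undup; have : [set k | lamp s k != 0%R] k by []; rewrite rE.
Qed.

Lemma fold_lamp_neq0 s j : fold_lamp s j != 0%R ->
  exists2 k, (rot1 n *~ k)%R = j & lamp s k != 0%R.
Proof.
move=> sj; apply: contrapT => no; case/eqP: sj.
apply: fsbig1 => k /eqP kj; apply/eqP/contraT => sk.
by case: no; exists k.
Qed.

Lemma fold_lamp1 j : fold_lamp 1 j = 0%R.
Proof. exact: fsbig1. Qed.

Lemma fold_lampM s t j :
  fold_lamp (s * t) j = (fold_lamp s j + fold_lamp t (j - rot1 n *~ cursor s))%R.
Proof.
have [rs _ rsP] := lamp_support s; have [rt _ rtP] := lamp_support t.
pose r := undup (rs ++ [seq (k + cursor s)%R | k <- rt]).
have ur : uniq r by apply: undup_uniq.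
have r_s k : lamp s k != 0%R -> k \in r.
  by move=> /rsP ks; rewrite mem_undup mem_cat ks.
have r_t k : lamp t (k - cursor s)%R != 0%R -> k \in r.
  move=> /rtP kt; rewrite mem_undup mem_cat; apply/orP; right.
  by apply/mapP; exists (k - cursor s)%R; rewrite ?subrK.
rewrite (fold_lampE _ ur) => [|k]; last first.
  rewrite /=; have [->|/r_s //] := eqVneq (lamp s k) 0%R.
  by rewrite add0r => /r_t.
rewrite (fold_lampE _ ur r_s) big_split; congr (_ + _)%R.
rewrite (@fold_lampE t [seq (k - cursor s)%R | k <- r]).
- rewrite big_map; apply: eq_bigl => k.
  by rewrite /over mulrzBr (inj_eq (addIr _)).
- by rewrite map_inj_uniq //; apply: addIr.
- move=> k tk; apply/mapP; exists (k + cursor s)%R; rewrite ?addrK //.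
  by apply: r_t; rewrite addrK.
Qed.

(** The imprimitive action of a wreath product: the cursor moves first and the lamp is read at the
    new position. *)
Definition lamp_act s (x : 'I_n.+1 * 'Z_p) : 'I_n.+1 * 'Z_p :=
  let j := (x.1 + rot1 n *~ cursor s)%R in (j, (x.2 + fold_lamp s j)%R).

Fact lamp_act1 x : lamp_act 1 x = x.
Proof. by case: x => i r; rewrite /lamp_act /= fold_lamp1 !addr0. Qed.

Fact lamp_actM s t x : lamp_act (s * t) x = lamp_act s (lamp_act t x).
Proof.
case: x => i r; rewrite /lamp_act /= fold_lampM mulrzDr.
have -> : (i + (rot1 n *~ cursor s + rot1 n *~ cursor t) =
  i + rot1 n *~ cursor t + rot1 n *~ cursor s)%R by rewrite addrAC addrA.
by rewrite addrK; congr pair; rewrite -[RHS]addrA; congr (_ + _)%R; apply: addrC.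
Qed.

Definition lamp_gset : gset (lamplighter p) := GSet lamp_act1 lamp_actM.

End LamplighterAction.

(* Changing the lamp state over [i] takes a trip from [i] to 0 and back: the two
   ends of the segment are the points at maximal distance from 0. *)
Definition lamp_height (p L : nat) (x : 'I_(2 * L).+1 * 'Z_p) : nat :=
  if x.2 == 0%R then L - circ_norm x.1 else (L + circ_norm x.1).+1.

Lemma circ_norm_le (L : nat) (z : 'I_(2 * L).+1) : (circ_norm z <= L)%N.
Proof. by rewrite /circ_norm; lia. Qed.

Lemma lamp_height_fibers (p L : nat) : fibers_le (@lamp_height p L) (#|'Z_p| * 2).
Proof.
move=> k s us sk; rewrite cardE.
(* At height [k] the lamp state determines the distance to 0, which leaves two positions for each
   state. *)
pose h (r : 'Z_p) := (r, if r == 0%R then L - k else k - L.+1)%N.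
rewrite -(size_map h).
apply: (@size_le_fibers _ _ (fun x : 'I_(2 * L).+1 * 'Z_p => (x.2, circ_norm x.1))) => //.
  move=> [r m] u uu um; rewrite -(size_map fst).
  apply: (@circ_norm_fibers _ m) => [|_ /mapP[x xu ->]]; last by case: (um x xu).
  rewrite map_inj_in_uniq // => -[i r1] [j r2] iu ju /= ->.
  by case: (um _ iu) (um _ ju) => -> _ [-> _].
move=> x xs; apply/mapP; exists x.2; first by rewrite mem_enum.
rewrite /h; congr pair; have := sk x xs; have := circ_norm_le x.1; rewrite /lamp_height.
by move: (circ_norm x.1) => c; case: ifP => _; lia.
Qed.

Lemma lamp_act_height (p L K : nat) (s : lamplighter p) (x : 'I_(2 * L).+1 * 'Z_p) :
  (forall k, lamp s k != 0%R -> (`|k| <= K)%N) ->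
  (lamp_height (lamp_act s x) <= lamp_height x + (2 * K + 1 + `|cursor s|))%N.
Proof.
move=> sK; case: x => i r; rewrite /lamp_act /lamp_height /=.
set j := (i + _)%R.
have ij : (circ_norm i <= circ_norm j + `|cursor s|)%N.
  have := circ_norm_rot j (- cursor s)%R; rewrite abszN mulrNz addrK.
  by [].
have ji : (circ_norm j <= circ_norm i + `|cursor s|)%N by apply: circ_norm_rot.
have iL := circ_norm_le i; have jL := circ_norm_le j.
(* The state changes only within distance [K] of 0, near the middle of the segment of heights, where
   crossing costs at most [2 * K + 1]. *)
have [->|/fold_lamp_neq0[k kj /sK kK]] := eqVneq (fold_lamp s j) 0%R.
  by rewrite addr0; case: ifP => _; lia.
have : (circ_norm j <= K)%N.
  rewrite -kj; have := circ_norm_rot (0%R : 'I_(2 * L).+1) k.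
  by rewrite add0r {2}/circ_norm /= min0n => /leq_trans; apply.
by case: ifP => _; case: ifP => _; lia.
Qed.

Lemma separated_lamplighter (p : nat) : exists C, linearly_separated C (lamplighter p).
Proof.
have /choice[K KP] : forall s : lamplighter p, exists K,
    forall k, lamp s k != 0%R -> (`|k| <= K)%N.
  move=> s; have [r _ rP] := lamp_support s; exists (\max_(k <- r) `|k|)%N => k /rP kr.
  exact: leq_bigmax_seq.
exists (maxn 2 (#|'Z_p| * 2)), (fun s => 2 * K s + 1 + `|cursor s|)%N => s s1.
have [c0|c0] := eqVneq (cursor s) 0%R; last first.
  have cM : {morph @cursor p : x y / x * y >-> (x + y)%R} by [].
  by have := int_witness cM c0; apply: separation_witnessW => [h|]; rewrite ?leq_addl ?leq_maxl.
have [r ur rP] := lamp_support s.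
(* A lit lamp farthest from 0. The support then embeds into the cycle of length [2 * |k0| + 1], so
   the lamp at [k0] is not cancelled, and it sits at maximal distance from 0. *)
have [k0 k0s k0max] : exists2 k0, lamp s k0 != 0%R &
    forall k, lamp s k != 0%R -> (`|k| <= `|k0|)%N.
  pose P m := `[< exists2 k, lamp s k != 0%R & `|k|%N = m >].
  have exP : exists m, P m.
    apply: contrapT => no; case/eqP: s1; apply: lamplighterP => [k|] //=.
    apply/eqP/contraT => sk; case: no; exists `|k|%N.
    by apply/asboolP; exists k.
  have ubP m : P m -> (m <= K s)%N by move=> /asboolP[k /KP + <-].
  case: (ex_maxnP exP ubP) => m /asboolP[k sk <-] kmax; exists k => // l sl.
  by apply: kmax; apply/asboolP; exists l.
set L := `|k0|%N in k0max.
have fs : fold_lamp s (rot1 (2 * L) *~ k0)%R = lamp s k0.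
  rewrite (fold_lampE _ ur rP) big_mkcond (bigD1_seq k0) ?rP //= /over eqxx.
  rewrite big1 ?addr0 // => k kn; case: eqP => // kk0; apply/eqP/contraT => sk.
  suff kE : k = k0 by rewrite kE eqxx in kn.
  apply/eqP; rewrite -subr_eq0; apply/eqP; apply: (@rot1_eq0 (2 * L)).
    by rewrite mulrzBr kk0 subrr.
  by have := k0max k sk; rewrite /L; lia.
have nk0 : circ_norm (rot1 (2 * L) *~ k0)%R = L by rewrite circ_norm_int //; lia.
apply: (@separation_witnessW _ _ _ (#|'Z_p| * 2)) (leq_maxr _ _) _ => // [h|]; first exact: leqnn.
exists (lamp_gset p (2 * L)), (@lamp_height p L), ((rot1 (2 * L) *~ k0)%R, 0%R).
have gx : lamp_height (lamp_act s ((rot1 (2 * L) *~ k0)%R, 0%R)) = (2 * L).+1.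
  by rewrite /lamp_act /lamp_height /= c0 addr0 fs add0r (negPf k0s) nk0; lia.
split; rewrite /= ?gx //.
- by rewrite /lamp_height eqxx nk0 subnn.
- by move=> z; rewrite /lamp_height; have := circ_norm_le z.1; case: ifP; lia.
- by move=> h z; apply: lamp_act_height; apply: KP.
- exact: lamp_height_fibers.
Qed.

(** * Finite generation of lamplighter groups *)

Section LamplighterGenerators.
Variable p : nat.

Definition ll_lamp (k : int) (r : 'Z_p) : lamplighter p.
Proof.
apply: (@Lamplighter p (fun i => if i == k then r else 0%R) 0%R).
by apply: sub_finite_set (finite_set1 k) => i /=; have [->//|_ /eqP] := eqVneq i k.
Defined.

Definition ll_move (m : int) : lamplighter p.
Proof.
apply: (@Lamplighter p (fun=> 0%R) m).
by apply: sub_finite_set (finite_set0 int) => i /eqP.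
Defined.

(** Lamps at [k] are conjugates of lamps at 0 by translations; an element with cursor 0 is a product
    of lamps, by induction on a list containing its support. *)
Lemma fin_gen_lamplighter : fin_gen [set: lamplighter p].
Proof.
exists [:: ll_move 1%R; ll_lamp 0 1%R]; apply/esym/seteqP; split=> // s _.
set S := [set` _]; have [S1 SM SV] := generated_subgroup S.
have SS x : x \in [:: ll_move 1%R; ll_lamp 0 1%R] -> generated S x.
  by move=> xS H [_]; apply.
have move_gen m : generated S (ll_move m).
  have pos k : generated S (ll_move k%:Z).
    elim: k => [|k IH]; first by rewrite (_ : ll_move _ = 1) //; apply: lamplighterP.
    rewrite (_ : ll_move _ = ll_move k%:Z * ll_move 1%R).
      by apply: (SM) => //; apply: SS; rewrite mem_head.
    by apply: lamplighterP => [i|] /=; rewrite ?addr0 // -addn1.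
  case: m => k; first exact: pos.
  rewrite (_ : ll_move _ = (ll_move k.+1%:Z)^-1); first exact: SV.
  by apply: lamplighterP => [i|] /=; rewrite ?oppr0 ?NegzE.
have lamp_gen k r : generated S (ll_lamp k r).
  have -> : ll_lamp k r = ll_move k * ll_lamp 0 r * ll_move (- k).
    apply: lamplighterP => [i|] /=; last by rewrite addr0 subrr.
    by rewrite add0r addr0 subr_eq0.
  apply: (SM) => //; apply: (SM) => //; rewrite -[r]natr_Zp.
  elim: (r : nat) => [|m IH].
    rewrite (_ : ll_lamp _ _ = 1) //; apply: lamplighterP => // i /=.
    by case: ifP.
  rewrite (_ : ll_lamp _ _ = ll_lamp 0 1%R * ll_lamp 0 (m%:R)%R).
    by apply: (SM) => //; apply: SS; rewrite !inE eqxx orbT.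
  apply: lamplighterP => [i|] /=; rewrite ?subr0 ?addr0 //.
  by case: ifP => _; rewrite ?addr0 // mulrS.
have supp_gen (r : seq int) (t : lamplighter p) : cursor t = 0%R ->
    (forall k, lamp t k != 0%R -> k \in r) -> generated S t.
  elim: r t => [|k r IH] t t0 tr.
    rewrite (_ : t = 1) //; apply: lamplighterP => // i /=.
    by apply/eqP/contraT => /tr.
  rewrite (_ : t = ll_lamp k (lamp t k) * (ll_lamp k (- lamp t k)%R * t)).
    apply: (SM) => //; apply: IH => [|i] /=; first by rewrite add0r.
    rewrite subr0; have [->|ik] := eqVneq i k; first by rewrite addNr eqxx.
    by rewrite add0r => /tr; rewrite inE (negPf ik).
  apply: lamplighterP => [i|] /=; last by rewrite !add0r.
  by rewrite !subr0; case: ifP => [/eqP ->|_]; rewrite ?add0r // addrA subrr add0r.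
have -> : s = s * ll_move (- cursor s) * ll_move (cursor s).
  by apply: lamplighterP => [i|] /=; rewrite ?addr0 // subrK.
apply: (SM) => //; have [r _ rP] := lamp_support s.
by apply: (supp_gen r) => [|k] /=; rewrite ?subrr // addr0 => /rP.
Qed.

End LamplighterGenerators.

(** * Building blocks *)

Lemma generated_sub (G : groupType) (S T : set G) :
  S `<=` generated T -> generated S `<=` generated T.
Proof. by move=> ST x /(_ (generated T)); apply; split=> //; apply: generated_subgroup. Qed.

Lemma sub_generated (G : groupType) (S : set G) : S `<=` generated S.
Proof. by move=> x Sx H [_]; apply. Qed.

Lemma image_generated (G K : groupType) (f : G -> K) (S : seq G) (x : G) :
  {morph f : x y / x * y} -> generated [set` S] x -> generated [set` map f S] (f x).
Proof.
move=> fM; have [h1 hM hV] := generated_subgroup [set` map f S].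
move=> /(_ [set x | generated [set` map f S] (f x)]); apply; split=> [|y yS]; last first.
  by apply: sub_generated; apply: map_f.
split=> /= [|y z|y]; rewrite ?(morph_1 fM) ?fM ?(morph_V fM) //; first exact: hM.
exact: hV.
Qed.

Lemma fin_gen_isog (G K : groupType) (H : set K) :
  isog_onto G H -> fin_gen H -> fin_gen [set: G].
Proof.
case=> f [finj fH] [S SH]; have fM : {morph f : x y / x * y} by apply: gmulfM.
have [S' S'E] : exists S', map f S' = S.
  have : forall y, y \in S -> exists x, f x = y.
    move=> y yS; have : H y by rewrite SH; apply: sub_generated.
    by rewrite -fH => -[x _ <-]; exists x.
  elim: (S) => [|y s IH] ys; first by exists [::].
  have [|s' <-] := IH; first by move=> z zs; apply: ys; rewrite inE zs orbT.
  by have [x <-] := ys y (mem_head _ _); exists (x :: s').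
exists S'; apply/esym/seteqP; split=> // x _.
have : H (f x) by rewrite -fH; exists x.
have [h1 hM hV] := generated_subgroup [set` S'].
rewrite SH => fx.
suff: (f @` generated [set` S']) (f x) by move=> [y yS /finj <-].
apply: (fx (f @` generated [set` S'])); split=> [|z /=]; last first.
  by rewrite -S'E => /mapP[y yS ->]; exists y => //; apply: sub_generated.
split=> [|_ _ [y yS <-] [z zS <-]|_ [y yS <-]].
- by exists 1; rewrite ?(morph_1 fM).
- by exists (y * z); rewrite ?fM //; apply: hM.
- by exists y^-1; rewrite ?(morph_V fM) //; apply: hV.
Qed.

Lemma fin_gen_finite (G : groupType) : finite_set [set: G] -> fin_gen [set: G].
Proof.
move=> /finite_seqP[S SE]; exists S; apply/esym/seteqP; split=> // x _.
by apply: sub_generated; rewrite -SE.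
Qed.

Lemma fp_injM (I : choiceType) (G : I -> groupType) (i : I) :
  {morph @fp_inj I G i : x y / x * y}.
Proof.
move=> x y; rewrite [RHS](_ : _ = fp_word [:: mk_letter x; mk_letter y]).
  by apply/esym/fp_wordP/(FpMul [::]).
by rewrite -[[:: _; _]]/([:: mk_letter x] ++ [:: mk_letter y]) fp_word_cat.
Qed.

Lemma fin_gen_graph_product (I : finType) (c : I -> I -> bool) (G : I -> groupType) :
  (forall i, fin_gen [set: G i]) -> fin_gen [set: graph_product c G].
Proof.
move=> fgG; pose S i := projT1 (cid (fgG i)).
have SP i : generated [set` S i] = [set: G i] := esym (projT2 (cid (fgG i))).
pose f i (x : G i) : graph_product c G := quo_mk _ (fp_inj x).
have fM i : {morph @f i : x y / x * y}.
  by move=> x y; rewrite /f fp_injM quo_mk_morph.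
pose T := flatten [seq map (@f i) (S i) | i <- enum I].
have [T1 TM _] := generated_subgroup [set` T].
have fT i (x : G i) : generated [set` T] (f i x).
  have : generated [set` map (@f i) (S i)] (f i x).
    by apply: image_generated => //; rewrite SP.
  apply: generated_sub => y yS; apply: sub_generated.
  by apply/flattenP; exists (map (@f i) (S i)) => //; apply: map_f; rewrite mem_enum.
exists T; apply/esym/seteqP; split=> // a _.
have [w <-] := gp_word_repr a; elim: w => [|[i x] w IH]; first exact: T1.
by rewrite gp_word_cons; apply: TM => //; apply: fT.
Qed.

Lemma fin_gen_building_block (G : groupType) : building_block G -> fin_gen [set: G].
Proof.
case=> [||[I [c [A [H [_ _ _ fgH iso]]]]]|iso|p _ iso] //.
- exact: fin_gen_finite.
- exact: fin_gen_isog iso fgH.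
- by apply: fin_gen_isog iso _; exists [:: aut_a; aut_b; aut_c; aut_d].
- exact: fin_gen_isog iso (fin_gen_lamplighter p).
Qed.

Lemma separated_building_block (G : groupType) :
  building_block G -> exists C, linearly_separated C G.
Proof.
case=> [|fgG mulC|[I [c [A [H [c_sym cycA _ _ [f [finj _]]]]]]]||p _ [f [finj _]]].
- exact: separated_finite.
- exact: separated_abelian.
- have fM : {morph f : x y / x * y} by apply: gmulfM.
  (* All infinite cyclic groups share the constant 2, so infinitely many vertices are allowed
     here. *)
  exists (2 * 2)%N; apply: separated_inj fM finj _.
  by apply: separated_graph_product => // i; apply: separated_infinite_cyclic.
- exact: separated_Grigorchuk.
- have [C HC] := separated_lamplighter p; exists C.
  have fM : {morph f : x y / x * y} by apply: gmulfM.
  exact: separated_inj fM finj HC.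
Qed.

Lemma graph_product_fin_gen_separated (I : finType) (c : I -> I -> bool) (G : I -> groupType) :
  (forall i j : I, i != j -> c i j = c j i) ->
  (forall i : I, building_block (G i)) ->
  fin_gen [set: graph_product c G] /\ exists C, linearly_separated C (graph_product c G).
Proof.
move=> c_sym blk; split.
  by apply: fin_gen_graph_product => i; apply: fin_gen_building_block.
have /choice[C HC] : forall i, exists C, linearly_separated C (G i).
  by move=> i; apply: separated_building_block.
(* The successor keeps the common constant positive, even if there are no vertices. *)
exists (2 * (\max_i C i).+1)%N; apply: separated_graph_product => // i.
by apply: separatedW (HC i); apply: leqW; apply: leq_bigmax.
Qed.

(** Without commuting pairs there are no relators, and their normal closure is trivial. *)
Lemma free_product_graph_product (I : choiceType) (G : I -> groupType) :
  isog_onto (free_product G) [set: graph_product (fun _ _ => false) G].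
Proof.
pose f := quo_mk (graph_relators (fun _ _ => false) (G := G)).
pose fm := isMultiplicative.Build _ _ f (@quo_mk_morph _ _).
pose h := HB.pack_for
  {multiplicative free_product G -> graph_product (fun _ _ => false) G} f fm.
exists h; split=> [x y /quo_mkP xy|]; last first.
  by apply/seteqP; split=> // a _; exists (repr a); rewrite //= /f quo_mkK.
have : [set 1] (x^-1 * y) => [|/= xy1]; last by rewrite -[y](mulVKg x) xy1 mulg1.
apply: xy; split; last by move=> r [i [j [u [v []]]]].
split; first by split=> // [u v -> ->|u ->]; rewrite ?mulg1 ?invg1.
by move=> u v ->; rewrite conj1g.
Qed.

Theorem proposition1p3 :
  (forall (k : nat) (G : 'I_k -> groupType),
     (1 <= k)%N ->
     (forall i : 'I_k, building_block (G i)) ->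
     class_lin (free_product G))
  /\
  (forall (I : finType) (c : I -> I -> bool) (G : I -> groupType),
     (forall i j : I, i != j -> c i j = c j i) ->
     (forall i : I, building_block (G i)) ->
     class_lin (graph_product c G)).
Proof.
split=> [k G _ blk|I c G c_sym blk]; last first.
  have [fgG [C HC]] := graph_product_fin_gen_separated c_sym blk.
  exact: class_lin_separated HC.
have [|fgG [C HC]] := @graph_product_fin_gen_separated _ (fun _ _ => false) G _ blk; first by [].
have iso := free_product_graph_product G.
apply: (@class_lin_separated C); first exact: fin_gen_isog iso fgG.
case: iso => f [finj _].
have fM : {morph f : x y / x * y} by apply: gmulfM.
exact: separated_inj fM finj HC.
Qed.
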